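(* Let $(X,d,\mu)$ be a space of homogeneous type. Given $0\leq\eta<1$, let $p(\cdot):X\to[1,\infty]$ be a measurable function such that $1/p(\cdot)\in LH$ and $1=p_-\leq p_+\leq 1/\eta$. Then there exists a positive constant $C=C(p(\cdot),\eta,X)$ such that for all $f\in L^{p(\cdot)}(X)$, $$\sup_{t>0}\,t\,\|\chi_{\{x\in X:\,M_\eta f(x)>t\}}\|_{q(\cdot)}\leq C\|f\|_{p(\cdot)},$$ where $q(\cdot)$ is defined pointwise by $1/p(\cdot)-1/q(\cdot)=\eta$. Furthermore, if $\mu(X)<+\infty$, the hypothesis $1/p(\cdot)\in LH$ can be replaced by $1/p(\cdot)\in LH_0$.
   Context: Conventions: $1/\infty=0$ and $1/0=\infty$; $\chi_E$ is the indicator function of $E$. A quasi-metric space $(X,d)$ is a set $X$ with $d:X\times X\to[0,\infty)$ such that $d(x,y)=0$ iff $x=y$, $d(x,y)=d(y,x)$, and $d(x,y)\le A_0(d(x,z)+d(y,z))$ for all $x,y,z$ and some constant $A_0\ge1$. Write $B(x,r)$ for the ball with center $x$ and radius $r>0$. $(X,d,\mu)$ is a space of homogeneous type if $(X,d)$ is a quasi-metric space, $\mu$ is a positive measure defined on the $\sigma$-algebra generated by quasi-metric balls and open sets, $0<\mu(B)<\infty$ for every ball $B$, and there is $C_\mu\ge1$ with $\mu(B(x,2r))\le C_\mu\,\mu(B(x,r))$ for all $x\in X$, $r>0$. Fractional maximal operator: for $0\le\eta<1$, $$M_\eta f(x)=\sup_{B\ni x}\mu(B)^{\eta}\,\frac1{\mu(B)}\int_B|f|\,d\mu,$$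 the supremum being over all balls $B$ containing $x$. Variable Lebesgue spaces: for measurable $p(\cdot):X\to[1,\infty]$ let $\Omega_\infty^{p(\cdot)}=\{x\in X:p(x)=\infty\}$ and $$\rho_{p(\cdot)}(f)=\int_{X\setminus\Omega_\infty^{p(\cdot)}}|f(x)|^{p(x)}\,d\mu(x)+\|f\|_{L^\infty(\Omega_\infty^{p(\cdot)})}.$$ $L^{p(\cdot)}(X)$ is the set of measurable $f$ with $\rho_{p(\cdot)}(f/\lambda)<\infty$ for some $\lambda>0$, with norm $\|f\|_{p(\cdot)}=\inf\{\lambda>0:\rho_{p(\cdot)}(f/\lambda)\le1\}$. Put $p_-=\operatorname{ess\,inf}_{x\in X}p(x)$ and $p_+=\operatorname{ess\,sup}_{x\in X}p(x)$. Log-Hölder conditions: for $r(\cdot):X\to[0,\infty)$, $r(\cdot)\in LH_0$ if there is $C_0$ with $|r(x)-r(y)|\le \frac{-C_0}{\log d(x,y)}$ for all $x\neq y$ in $X$ with $d(x,y)<1/2$. $r(\cdot)\in LH_\infty$ (with respect to a base point $x_0\in X$; the choice of base point is immaterial up to changing the constant) if there are constants $C_\infty,r_\infty$ with $|r(x)-r_\infty|\le\frac{C_\infty}{\log(e+d(x,x_0))}$ for all $x\in X$. $LH=LH_0\cap LH_\infty$. *)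

(* Defs.v *)
From HB Require Import structures.
From mathcomp Require Import all_boot all_order all_algebra.
From mathcomp Require Import all_classical all_reals all_analysis.
From mathcomp Require Import measurable_realfun ess_sup_inf.

Set Implicit Arguments.
Unset Strict Implicit.
Unset Printing Implicit Defensive.

Import Order.TTheory GRing.Theory Num.Theory.
Import numFieldNormedType.Exports.

Local Open Scope classical_set_scope.
Local Open Scope ring_scope.

Record quasi_metric (R : realType) (X : Type) (d : X -> X -> R) : Prop := {
  qm_ge0 : forall x y, 0 <= d x y ;
  qm_eq0 : forall x y, d x y = 0 <-> x = y ;
  qm_sym : forall x y, d x y = d y x ;
  qm_triangle : exists A0 : R, 1 <= A0 /\
    forall x y z, d x y <= A0 * (d x z + d y z) }.

Definition qball (R : realType) (X : Type) (d : X -> X -> R) (x : X) (r : R) :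
  set X := [set y | d x y < r].

Definition qballs (R : realType) (X : Type) (d : X -> X -> R) : set (set X) :=
  [set B | exists x r, 0 < r /\ B = qball d x r].

(* Open sets of the topology induced by [d]; quasi-metric balls need not be
   open, which is why the sigma-algebra below is generated by both families. *)
Definition qopen (R : realType) (X : Type) (d : X -> X -> R) : set (set X) :=
  [set U | forall x, U x -> exists r, 0 < r /\ qball d x r `<=` U].

Record homogeneous_type (R : realType) (disp : measure_display)
    (X : measurableType disp) (d : X -> X -> R)
    (mu : {measure set X -> \bar R}) : Prop := {
  ht_quasi_metric : quasi_metric d ;
  ht_measurable : (measurable : set (set X)) = <<s qballs d `|` qopen d >> ;
  ht_ball_gt0 : forall (x : X) (r : R), 0 < r -> (0 < mu (qball d x r))%E ;
  ht_ball_fin : forall (x : X) (r : R), 0 < r -> (mu (qball d x r) < +oo)%E ;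
  ht_doubling : exists Cmu : R, 1 <= Cmu /\ forall (x : X) (r : R), 0 < r ->
    (mu (qball d x (2 * r)) <= Cmu%:E * mu (qball d x r))%E }.

Definition frac_maximal (R : realType) (disp : measure_display)
    (X : measurableType disp) (d : X -> X -> R)
    (mu : {measure set X -> \bar R}) (eta : R) (f : X -> R) (x : X) : \bar R :=
  ereal_sup [set (mu B `^ eta * ((mu B)^-1 * \int[mu]_(y in B) `|f y|%:E))%E
            | B in [set B | qballs d B /\ B x]].

Definition Omega_infty (R : realType) (X : Type) (p : X -> \bar R) : set X :=
  [set x | p x = +oo%E].

(* The second summand is the essential supremum of [|f|] over
   [Omega_infty p], written as the global L^oo norm of [f] cut off to that set;
   it is 0 when [Omega_infty p] is negligible. *)
Definition var_modular (R : realType) (disp : measure_display)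
    (X : measurableType disp) (mu : {measure set X -> \bar R})
    (p : X -> \bar R) (f : X -> R) : \bar R :=
  (\int[mu]_(x in ~` Omega_infty p) (`|f x| `^ fine (p x))%:E
   + 'N[mu]_+oo [(EFin \o f) \_ (Omega_infty p)])%E.

(* Equal to +oo outside of [L^p(.)] (infimum of the empty set). *)
Definition var_norm (R : realType) (disp : measure_display)
    (X : measurableType disp) (mu : {measure set X -> \bar R})
    (p : X -> \bar R) (f : X -> R) : \bar R :=
  ereal_inf [set l%:E | l in
    [set l : R | 0 < l /\ (var_modular mu p (fun x => (f x / l)%R) <= 1)%E]].

Definition var_Lebesgue (R : realType) (disp : measure_display)
    (X : measurableType disp) (mu : {measure set X -> \bar R})
    (p : X -> \bar R) : set (X -> R) :=
  [set f : X -> R | measurable_fun [set: X] f /\ exists l : R,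
    0 < l /\ (var_modular mu p (fun x => (f x / l)%R) < +oo)%E].

(* [1/p(.)] as a real-valued function: [(p x)^-1] uses the conventions
   [+oo^-1 = 0] and [0^-1 = +oo], and is finite as soon as [1 <= p x]. *)
Definition inv_exponent (R : realType) (X : Type) (p : X -> \bar R) (x : X) : R :=
  fine (p x)^-1%E.

Definition LH0 (R : realType) (X : Type) (d : X -> X -> R) (r : X -> R) : Prop :=
  exists C0 : R, forall x y, x <> y -> d x y < 2^-1 ->
    `|r x - r y| <= - C0 / ln (d x y).

Definition LHinfty (R : realType) (X : Type) (d : X -> X -> R) (x0 : X)
    (r : X -> R) : Prop :=
  exists Cinfty rinfty : R, forall x,
    `|r x - rinfty| <= Cinfty / ln (expR 1 + d x x0).

Definition LH (R : realType) (X : Type) (d : X -> X -> R) (x0 : X)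
    (r : X -> R) : Prop :=
  LH0 d r /\ LHinfty d x0 r.

(* When balls are not open, the level set below may fail to be measurable; its
   indicator is then given a norm through the total integral and ess_sup. *)
Definition weak_type_bound (R : realType) (disp : measure_display)
    (X : measurableType disp) (d : X -> X -> R)
    (mu : {measure set X -> \bar R}) (eta : R) (p q : X -> \bar R) : Prop :=
  exists C : R, 0 < C /\ forall f : X -> R, var_Lebesgue mu p f ->
    (ereal_sup [set t%:E *
        var_norm mu q \1_[set x | t%:E < frac_maximal d mu eta f x]
      | t in [set t : R | (0 < t)%R]]
     <= C%:E * var_norm mu p f)%E.

(* Main.v *)
Require Import Defs.
From mathcomp Require Import all_boot all_order all_algebra.
From mathcomp Require Import all_classical all_reals all_analysis.
From mathcomp Require Import measurable_realfun ess_sup_inf.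
From mathcomp Require Import ring lra.
Import Order.TTheory GRing.Theory Num.Theory.
Import numFieldNormedType.Exports.
Local Open Scope classical_set_scope.
Local Open Scope ring_scope.

(** Write [al = 1/p] and let [S] be an integrable negative power of
    [e + d x x0].  After normalising [f], the density [g = |f|^p + S] has
    integral at most a constant and [|f| <= g^al] almost everywhere.  Log-Hoelder
    continuity then bounds the fractional mean of [|f|] over a ball [B] by
    [C max(G, S y)^(al y - eta)], [G] the mean of [g] over [B], for every [y] in
    a fixed dilate of [B].  Hence, if a disjoint family of balls with fractional
    mean above [t] has dilates covering the level set, [(t/C)^q] is at most the
    sum of the [G]'s over the dilates plus [S], whose integral is controlled by
    doubling and disjointness.  The covering family is finite once sizes and
    positions of the balls are truncated; Fatou's lemma removes the truncation
    and makes the measurability of the level set irrelevant. *)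

(** * Real powers and dyadic rounding *)

Section RealPowers.
Context {R : realType}.
Implicit Types a b c g G t : R.

Lemma powR_expR a x : 0 < a -> a `^ x = expR (x * ln a).
Proof. by move=> a0; rewrite /powR gt_eqF. Qed.

(** A substitute for Jensen's inequality with varying exponents: the last factor is affine in [g]
    and averages to 2 when [G] is the mean of [g]. For [g > G], a power of [g / G] with exponent at
    most 1 is at most [g / G]. *)
Lemma powR_le_mul_ratio {g G a} : 0 < G -> 0 <= g -> 0 <= a <= 1 ->
  g `^ a <= G `^ a * (1 + g / G).
Proof.
move=> G0 g0 /andP[a0 a1].
have gG0 : 0 <= g / G by rewrite divr_ge0// ltW.
have [gG|Gg] := leP g G.
  apply: (@le_trans _ _ (G `^ a)).
    by apply: ge0_ler_powR => //; rewrite nnegrE// ltW.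
  by rewrite ler_peMr ?powR_ge0// lerDl.
have Gg_eq : G * (g / G) = g by rewrite mulrC divfK// lt0r_neq0.
rewrite -[in leLHS]Gg_eq powRM ?(ltW G0)//.
rewrite ler_wpM2l ?powR_ge0//.
apply: (@le_trans _ _ (g / G)); last by rewrite lerDr.
by apply: ler1_powR => //; rewrite ler_pdivlMr// mul1r ltW.
Qed.

(** The ratio of the two powers is [expR ((a - b) * ln G)]; this is how log-Hoelder bounds on
    exponents become bounds on powers. *)
Lemma powR_shift {G a b c} : 0 < G -> `|a - b| * `|ln G| <= c ->
  G `^ a <= expR c * G `^ b.
Proof.
move=> G0 h; rewrite !powR_expR// -expRD ler_expR -lerBlDr -mulrBl.
by apply: le_trans h; rewrite -normrM ler_norm.
Qed.

Lemma ln2_gt0 : 0 < ln (2 : R).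
Proof. by apply: ln_gt0; lra. Qed.

(** [k] counts the doublings needed to reach [1 + t]. Volume estimates use the lower bound on
    [2 ^+ k] and the logarithmic count; the dyadic bound on the decay weight uses the upper
    bound. *)
Lemma exists_expn2_ge t : 0 <= t ->
  exists k : nat, [/\ 1 + t <= 2 ^+ k, 2 ^+ k <= 2 * (1 + t) &
                      k%:R <= 1 + ln (1 + t) / ln (2 : R)].
Proof.
move=> t0; set s := ln (1 + t) / ln 2.
have s0 : 0 <= s by rewrite divr_ge0 ?ln_ge0//; lra.
exists (Num.trunc s).+1; have /andP[h1 h2] := truncn_itv s0.
have k_le : (Num.trunc s).+1%:R <= 1 + s by rewrite -natr1 addrC lerD2l.
have t1 : 0 < 1 + t by lra.
split=> //; rewrite -ler_ln ?posrE ?exprn_gt0 ?mulr_gt0//.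
  by rewrite lnXn// -[leRHS]mulr_natl -ler_pdivrMr ?ln2_gt0// ltW.
rewrite lnXn// -[leLHS]mulr_natl lnM ?posrE// -ler_pdivlMr ?ln2_gt0//.
by rewrite mulrDl divff// gt_eqF// ln2_gt0.
Qed.

Lemma ln_1DM_le {b t} : 0 <= t -> 1 <= b ->
  ln (1 + b * t) <= ln b + ln (1 + t).
Proof.
move=> t0 b1; have b0 : 0 < b by lra.
have t1 : 0 < 1 + t by lra.
have bt0 : 0 < 1 + b * t by rewrite ltr_wpDr// mulr_ge0// ltW.
by rewrite -lnM// ler_ln ?posrE ?mulr_gt0// mulrDr mulr1 lerD2r.
Qed.

End RealPowers.

(** * Volumes of balls under doubling *)

Definition qvol {R : realType} {disp : measure_display}
    {X : measurableType disp} (d : X -> X -> R)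
    (mu : {measure set X -> \bar R}) (x : X) (r : R) : R :=
  fine (mu (qball d x r)).

Section HomogeneousType.
Context {R : realType} {disp : measure_display} {X : measurableType disp}.
Context {d : X -> X -> R} {mu : {measure set X -> \bar R}}.
Hypothesis hX : homogeneous_type d mu.
Local Notation vol := (qvol d mu).

Let d_ge0 x y : 0 <= d x y. Proof. exact: (qm_ge0 (ht_quasi_metric hX)). Qed.
Let dxx x : d x x = 0. Proof. exact/(qm_eq0 (ht_quasi_metric hX)). Qed.
Let dC x y : d x y = d y x. Proof. exact: (qm_sym (ht_quasi_metric hX)). Qed.

Lemma quasi_triangle : exists2 A : R, 1 <= A &
  forall x y z, d x y <= A * (d x z + d z y).
Proof.
have [A [A1 hA]] := qm_triangle (ht_quasi_metric hX).
by exists A => // x y z; rewrite (dC z y).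
Qed.

Lemma qball_center x r : 0 < r -> qball d x r x.
Proof. by rewrite /qball /= dxx. Qed.

Lemma qball0 x r : r <= 0 -> qball d x r = set0.
Proof.
move=> r0; apply/seteqP; split => // y; rewrite /qball /= => h.
by have := le_lt_trans (d_ge0 x y) (lt_le_trans h r0); rewrite ltxx.
Qed.

Lemma measurable_qball x r : measurable (qball d x r).
Proof.
have [r0|r0] := leP r 0; first by rewrite qball0.
rewrite (ht_measurable hX); apply: sub_sigma_algebra; left.
by exists x, r.
Qed.

Lemma sub_qball x r s : r <= s -> qball d x r `<=` qball d x s.
Proof. by move=> rs y; rewrite /qball /= => /lt_le_trans; apply. Qed.

Lemma qball_fin_num x r : 0 < r -> mu (qball d x r) \is a fin_num.
Proof.
by move=> r0; rewrite ge0_fin_numE//; exact: (ht_ball_fin hX).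
Qed.

Lemma qvolE {x r} : 0 < r -> mu (qball d x r) = (vol x r)%:E.
Proof. by move=> r0; rewrite /qvol fineK// qball_fin_num. Qed.

Lemma qvol_gt0 {x r} : 0 < r -> 0 < vol x r.
Proof. by move=> r0; rewrite -lte_fin -qvolE//; exact: (ht_ball_gt0 hX). Qed.

Lemma le_qvol x y r s : 0 < r -> 0 < s -> qball d x r `<=` qball d y s ->
  vol x r <= vol y s.
Proof.
move=> r0 s0 h; rewrite -lee_fin -!qvolE// le_measure ?inE//; exact: measurable_qball.
Qed.

Lemma qvol_doubling : exists2 C : R, 1 <= C &
  forall (x : X) (r : R) (k : nat), 0 < r -> vol x (2 ^+ k * r) <= C ^+ k * vol x r.
Proof.
have [C [C1 hC]] := ht_doubling hX; exists C => // x r k r0.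
elim: k => [|k ih]; first by rewrite !expr0 !mul1r.
have k0 : 0 < 2 ^+ k * r by rewrite mulr_gt0 ?exprn_gt0.
apply: (@le_trans _ _ (C * vol x (2 ^+ k * r))).
  have k1 : 0 < 2 * (2 ^+ k * r) by rewrite mulr_gt0.
  by have := hC x _ k0; rewrite (qvolE k0) (qvolE k1) exprS -mulrA.
by rewrite exprS -mulrA ler_wpM2l// ltW// (lt_le_trans ltr01).
Qed.

Lemma qvol_dilate K : 1 <= K -> exists2 C : R, 1 <= C &
  forall (x : X) (r : R), 0 < r -> vol x (K * r) <= C * vol x r.
Proof.
move=> K1; have [C C1 hC] := qvol_doubling.
have [k [hk _ _]] := exists_expn2_ge _ (ltW (lt_le_trans ltr01 K1)).
exists (C ^+ k); first exact: exprn_ege1.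
move=> x r r0; apply: le_trans (hC x r k r0).
have K0 : 0 < K * r by rewrite mulr_gt0// (lt_le_trans ltr01).
apply: le_qvol => //; first by rewrite mulr_gt0 ?exprn_gt0.
by apply: sub_qball; rewrite ler_pM2r//; apply: le_trans hk; rewrite lerDr.
Qed.

(** The unit ball at [x0] lies in the ball about [x] of radius [A * (1 + d x x0)], which is reached
    from radius [r] by logarithmically many doublings. *)
Lemma ln_qvol_ge x0 : exists c1 c2 : R, [/\ 0 <= c1, 0 <= c2 &
  forall (x : X) (r : R), 0 < r -> - ln (vol x r) <= c1 + c2 * ln (1 + (1 + d x x0) / r)].
Proof.
have [A A1 hA] := quasi_triangle; have [C C1 hC] := qvol_doubling.
have l2 := @ln2_gt0 R; have A0 : 0 < A by lra.
have lnA : 0 <= ln A by rewrite ln_ge0.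
have lnC : 0 <= ln C by rewrite ln_ge0.
exists ((1 + ln A / ln 2) * ln C + `|ln (vol x0 1)|), (ln C / ln 2).
split=> [||x r r0].
- by rewrite addr_ge0// mulr_ge0// addr_ge0// divr_ge0// ltW.
- by rewrite divr_ge0// ltW.
have D0 := d_ge0 x x0.
set T := (1 + d x x0) / r; have T0 : 0 <= T by rewrite divr_ge0// ?ltW//; lra.
have [|k [hk1 _ hk2]] := @exists_expn2_ge R (A * T); first by rewrite mulr_ge0// ltW.
have k0 : 0 < 2 ^+ k * r by rewrite mulr_gt0 ?exprn_gt0.
have h1 : vol x0 1 <= C ^+ k * vol x r.
  apply: le_trans (hC x r k r0); apply: le_qvol => // y /=.
  rewrite /qball /= => hy.
  have hr : A * (1 + d x x0) <= 2 ^+ k * r.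
    rewrite -ler_pdivrMr// -mulrA -/T; apply: le_trans hk1.
    by rewrite lerDr.
  apply: lt_le_trans hr; apply: le_lt_trans (hA x y x0) _.
  by rewrite ltr_pM2l// addrC ltrD2r.
have v0 : 0 < vol x0 1 := qvol_gt0 ltr01.
have vr : 0 < vol x r := qvol_gt0 r0.
have C0 : 0 < C by lra.
have h2 : ln (vol x0 1) <= k%:R * ln C + ln (vol x r).
  rewrite mulr_natl -lnXn// -lnM ?posrE ?exprn_gt0//.
  by rewrite ler_ln ?posrE ?mulr_gt0 ?exprn_gt0.
have h3 := ln_1DM_le T0 A1.
have h4 : k%:R * ln C <= (1 + ln A / ln 2 + ln (1 + T) / ln 2) * ln C.
  rewrite ler_wpM2r//; apply: le_trans hk2 _.
  by rewrite -addrA lerD2l -mulrDl ler_pM2r// invr_gt0.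
have h5 : - ln (vol x0 1) <= `|ln (vol x0 1)| by rewrite -normrN ler_norm.
have e : (1 + ln A / ln 2 + ln (1 + T) / ln 2) * ln C =
  (1 + ln A / ln 2) * ln C + ln C / ln 2 * ln (1 + T) by ring.
rewrite e in h4; lra.
Qed.

End HomogeneousType.

(** * An integrable power weight *)

(** This is [e + d x x0] to the power [-m]; the summand [e] keeps the logarithm at least 1. *)
Definition decay {R : realType} {X : Type} (d : X -> X -> R) (x0 : X)
    (m : nat) (x : X) : R :=
  expR (- (m%:R * ln (expR 1 + d x x0))).

Section DecayWeight.
Context {R : realType} {disp : measure_display} {X : measurableType disp}.
Context {d : X -> X -> R} {mu : {measure set X -> \bar R}}.
Hypothesis hX : homogeneous_type d mu.
Local Notation vol := (qvol d mu).

Let d_ge0 x y : 0 <= d x y. Proof. exact: (qm_ge0 (ht_quasi_metric hX)). Qed.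

(** Strict sublevel sets are balls, which lie in the sigma-algebra even when they are not open. *)
Lemma measurable_fun_dist (x0 : X) : measurable_fun [set: X] (d ^~ x0).
Proof.
apply: (measurability _ (RGenInftyO.measurableE R)) => //.
move=> /= _ [_ [r ->] <-]; apply: measurableI => //.
rewrite [X in measurable X](_ : _ = qball d x0 r).
  exact: (measurable_qball hX).
apply/seteqP; split => x /=; rewrite in_itv /= /qball /=;
  by rewrite (qm_sym (ht_quasi_metric hX)).
Qed.

Lemma decay_gt0 x0 m x : 0 < decay d x0 m x. Proof. exact: expR_gt0. Qed.

Lemma ln_eD_ge1 x0 x : 1 <= ln (expR 1 + d x x0).
Proof.
rewrite -[leLHS](expRK 1) ler_ln ?posrE ?expR_gt0 ?lerDl//.
by rewrite ltr_wpDr// expR_gt0.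
Qed.

Lemma decay_le1 x0 m x : decay d x0 m x <= 1.
Proof.
by rewrite expR_le1 oppr_le0 mulr_ge0// (le_trans ler01 (ln_eD_ge1 x0 x)).
Qed.

Lemma measurable_decay x0 m : measurable_fun [set: X] (decay d x0 m).
Proof.
apply: (measurableT_comp (@measurable_expR R)).
apply: measurableT_comp => //.
apply: measurable_funM => //.
apply: (measurableT_comp (@measurable_ln R)).
by apply: measurable_funD => //; exact: measurable_fun_dist.
Qed.

(* Over the ball of radius [2^k] the weight is at most [2^m / 2^(k m)], and the
   volume of that ball grows at most like [C^k], [C] the doubling constant. *)
Lemma integral_decay_fin x0 : exists (m : nat) (M : R),
  0 <= M /\ (\int[mu]_x (decay d x0 m x)%:E <= M%:E)%E.
Proof.
have [C C1 hC] := qvol_doubling hX.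
(* Having [2 * C <= 2 ^+ m] beats the volume growth [C ^+ k] and leaves a factor [2 ^- k] for the
   summation. *)
have [m [hm _ _]] := exists_expn2_ge (2 * C) (mulr_ge0 (ler0n R 2) (le_trans ler01 C1)).
set V := vol x0 1; have V0 : 0 < V := qvol_gt0 hX ltr01.
pose B k := qball d x0 (2 ^+ k).
have k0 k : (0 : R) < 2 ^+ k by rewrite exprn_gt0.
have mB k : measurable (B k) by exact: (measurable_qball hX).
pose a k : R := 2 ^+ m / (2 ^+ k) ^+ m.
have a0 k : 0 <= a k by rewrite divr_ge0// ltW// exprn_gt0.
pose h k x := ((a k)%:E * (\1_(B k) x)%:E)%E.
have h0 k x : (0 <= h k x)%E by rewrite mule_ge0 ?lee_fin.
have mh k : measurable_fun [set: X] (h k).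
  by apply: emeasurable_funM => //; apply/measurable_EFinP.
exists m, (2 * 2 ^+ m * V); split.
  by rewrite !mulr_ge0// ?ltW.
apply: (@le_trans _ _ (\int[mu]_x (\sum_(k <oo) h k x)%E)%E).
  apply: ge0_le_integral => //.
  - by move=> x _; rewrite lee_fin ltW// decay_gt0.
  - by apply/measurable_EFinP; exact: measurable_decay.
  - by apply: ge0_emeasurable_sum.
  (* One term suffices: [x] lies in [B k], and [2 ^+ k <= 2 * (1 + d x x0)] makes [a k] dominate the
     weight. *)
  move=> x _; have [k [hk1 hk2 _]] := exists_expn2_ge _ (d_ge0 x x0).
  apply: (@le_trans _ _ (\sum_(0 <= i < k.+1) h i x)%E); last first.
    by apply: nneseries_lim_ge => n _ _; exact: h0.
  rewrite big_nat_recr//=; apply: (@le_trans _ _ (h k x)); last first.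
    by rewrite leeDr// sume_ge0.
  rewrite /h indicE mem_set; last first.
    rewrite /B /qball /= (qm_sym (ht_quasi_metric hX)).
    by apply: lt_le_trans hk1; rewrite ltrDr.
  rewrite mule1 lee_fin /decay expRN.
  have e0 : 0 < expR 1 + d x x0 by rewrite ltr_wpDr// expR_gt0.
  rewrite expRM_natl lnK ?posrE// /a -expr_div_n -[leRHS]invrK lef_pV2; last 2 first.
  - by rewrite posrE exprn_gt0.
  - by rewrite posrE invr_gt0 exprn_gt0// divr_gt0.
  rewrite -exprVn invf_div; apply: lerXn2r.
  - by rewrite nnegrE ltW// divr_gt0.
  - by rewrite nnegrE ltW.
  rewrite ler_pdivrMr// mulrC; apply: (le_trans hk2).
  have := @expR_ge1Dx R 1; lra.
rewrite integral_nneseries//.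
(* The bound [2 ^+ m * V / 2 ^+ k] is written over [2 ^ k.+1], the geometric shape summed by
   [epsilon_trick0]; hence the leading 2. *)
apply: (@le_trans _ _ (\sum_(k <oo) ((2 * 2 ^+ m * V) / (2 ^ k.+1)%:R)%:E)%E);
  last by apply: epsilon_trick0; rewrite !mulr_ge0// ltW.
apply: lee_nneseries => [k _ _|k _]; first exact: integral_ge0.
rewrite /h ge0_integralZl_EFin//; last by apply/measurable_EFinP.
rewrite integral_indic// setIT /B (qvolE hX)// -EFinM lee_fin.
have hV := hC x0 1 k ltr01; rewrite mulr1 -/V in hV.
apply: (le_trans (ler_wpM2l (a0 k) hV)).
rewrite /a natrX exprS -/V invfM.
have -> : 2 * 2 ^+ m * V * (2^-1 / 2 ^+ k) = 2 ^+ m * (V / 2 ^+ k).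
  by move: (k0 k) (k0 m) => /lt0r_neq0 + _; move: (2 ^+ k) (2 ^+ m); intros; field.
rewrite -mulrA ler_wpM2l ?(ltW (k0 m))//.
have key : C ^+ k * 2 ^+ k <= (2 ^+ k) ^+ m.
  rewrite -exprMn -exprM mulnC exprM; apply: lerXn2r.
  - by rewrite nnegrE mulr_ge0// (le_trans ler01 C1).
  - by rewrite nnegrE.
  by apply: le_trans hm; rewrite mulrC lerDr.
rewrite ler_pdivlMr// -mulrA ler_pdivrMl ?exprn_gt0//.
by rewrite mulrAC ler_pM2r.
Qed.

End DecayWeight.

(** * Oscillation of log-Hoelder exponents *)

Section LogHolder.
Context {R : realType} {disp : measure_display} {X : measurableType disp}.
Context {d : X -> X -> R} {mu : {measure set X -> \bar R}}.
Hypothesis hX : homogeneous_type d mu.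
Local Notation vol := (qvol d mu).

Let d_ge0 x y : 0 <= d x y. Proof. exact: (qm_ge0 (ht_quasi_metric hX)). Qed.
Let dC x y : d x y = d y x. Proof. exact: (qm_sym (ht_quasi_metric hX)). Qed.

Variables (x0 : X) (al : X -> R).

Lemma LH0_mul_ln : LH0 d al -> exists2 C : R, 0 <= C &
  forall x y, d x y < 2^-1 -> `|al x - al y| * - ln (d x y) <= C.
Proof.
move=> [C hC]; exists `|C| => // x y hxy.
have [<-|nxy] := pselect (x = y); first by rewrite subrr normr0 mul0r.
have d0 : 0 < d x y.
  rewrite lt_neqAle d_ge0 andbT eq_sym; apply/eqP.
  by move/(qm_eq0 (ht_quasi_metric hX)).
have ln0 : 0 < - ln (d x y) by rewrite oppr_gt0 ln_lt0// d0/=; lra.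
rewrite -ler_pdivlMr//; apply: le_trans (hC x y nxy hxy) _.
rewrite invrN mulrN mulNr lerN2.
by apply: ler_wnM2r; [rewrite invr_le0; lra|exact: ler_norm].
Qed.

(* Projecting the limit exponent onto [lo, hi] does not increase its distance
   to the values of [al]. *)
Lemma LHinfty_mul_ln lo hi : (forall x, lo <= al x <= hi) -> LHinfty d x0 al ->
  exists (ainf C : R), [/\ lo <= ainf <= hi, 0 <= C &
  forall x, `|al x - ainf| * ln (expR 1 + d x x0) <= C].
Proof.
move=> hal [C [rinf hC]]; have /andP[lo0 hi0] := hal x0.
exists (if rinf < lo then lo else if hi < rinf then hi else rinf), `|C|.
split=> // [|x].
  by have [?|?] := ltP rinf lo; last have [?|?] := ltP hi rinf;
    apply/andP; split; lra.
have h1 := ln_eD_ge1 hX x0 x; have lx0 : 0 < ln (expR 1 + d x x0) by lra.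
apply: (@le_trans _ _ C); last exact: ler_norm.
rewrite -ler_pdivlMr//; apply: le_trans (hC x).
have /andP[lox hix] := hal x.
have [?|?] := ltP rinf lo; last have [?|?] := ltP hi rinf => //.
  by rewrite !ger0_norm; lra.
by rewrite !ler0_norm; lra.
Qed.

Hypothesis al01 : forall x, 0 <= al x <= 1.
Hypothesis al_LH0 : LH0 d al.
Hypothesis al_LHinf : LHinfty d x0 al.

Let dal_le1 z y : `|al z - al y| <= 1.
Proof.
by have /andP[? ?] := al01 z; have /andP[? ?] := al01 y;
  rewrite ler_norml; apply/andP; split; lra.
Qed.

(* Balls of radius comparable to, or larger than, their distance to [x0] need
   nothing; the others lie far from [x0], where [LHinfty] absorbs the factor
   [1 + d x x0] and [LH0] the factor [1 + 1 / r]. *)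
Lemma log_holder_osc K : 1 <= K -> exists c : R,
  forall (x z y : X) (r : R), 0 < r -> d x z < K * r -> d x y < K * r ->
  `|al z - al y| * ln (1 + (1 + d x x0) / r) <= c.
Proof.
move=> K1; have [A A1 hA] := quasi_triangle hX.
have [C0 C00 hC0] := LH0_mul_ln al_LH0.
have [ainf [Ci [_ Ci0 hCi]]] := LHinfty_mul_ln 0 1 al01 al_LHinf.
(* [M * r] bounds the distance between any two points of the dilated ball; [M] also serves as the
   threshold separating large balls from far ones. *)
pose M := 2 * A * K; pose lM := ln (1 + M).
have AK1 : 1 <= A * K by rewrite -[leLHS]mulr1 ler_pM.
have M2 : 2 <= M by rewrite /M -mulrA; lra.
(* Once [r^-1] exceeds [s0], [M * r] is below 1/2 and its square is at most [r]: [LH0] applies to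
   [z] and [y] and controls [- ln r]. *)
pose s0 := M ^+ 2 * 4.
exists (lM + 2 * Ci * (ln (2 * A) + 1) + (ln (1 + s0) + 4 * C0)).
move=> x z y r r0 hz hy.
set del := `|al z - al y|; have del0 : 0 <= del by exact: normr_ge0.
have del1 : del <= 1 by exact: dal_le1.
have lM0 : 0 <= lM by rewrite ln_ge0//; lra.
have l2A : 0 <= ln (2 * A) by rewrite ln_ge0//; lra.
have s00 : 4 <= s0.
  have : 1 <= M ^+ 2 by rewrite exprn_ege1//; lra.
  rewrite /s0; lra.
have ls0 : 0 <= ln (1 + s0) by rewrite ln_ge0//; lra.
have D0 := d_ge0 x x0; set D := d x x0 in D0 *.
have t20 : 0 <= 2 * Ci * (ln (2 * A) + 1) by rewrite !mulr_ge0//; lra.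
have [hr|hr] := leP (1 + D) (M * r).
  have hT : (1 + D) / r <= M by rewrite ler_pdivrMr.
  have T0 : 0 <= (1 + D) / r by rewrite divr_ge0 ?(ltW r0)//; lra.
  apply: (@le_trans _ _ lM); last lra.
  apply: (@le_trans _ _ (ln (1 + (1 + D) / r))).
    by apply: ler_piMl => //; rewrite ln_ge0// lerDl.
  by rewrite ler_ln ?posrE ?lerD2l//; lra.
(* In a far ball [1 + D] is at most a multiple of [e + d w x0], so [LHinfty] at [w] controls the
   logarithm taken at the center. *)
have hfar w : d x w < K * r -> `|al w - ainf| * ln (1 + D) <= Ci * (ln (2 * A) + 1).
  move=> hw; have hb : 1 + D <= 2 * A * (expR 1 + d w x0).
    have h1 := hA x x0 w; rewrite -/D in h1.
    have h2 : A * d x w <= A * (K * r) by rewrite ler_pM2l ?ltW//; lra.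
    have h3 : A * (K * r) = M * r / 2 by rewrite /M; field.
    have h4 := @expR_ge1Dx R 1.
    have h5 : 2 * A * 1 <= 2 * A * expR 1 by rewrite ler_pM2l; lra.
    rewrite mulrDr in h1; rewrite mulrDr; lra.
  have w0 := d_ge0 w x0; have e0 := @expR_gt0 R 1.
  have h6 : ln (1 + D) <= ln (2 * A) + ln (expR 1 + d w x0).
    rewrite -lnM ?posrE; [|lra|lra].
    by rewrite ler_ln ?posrE//; [lra|rewrite mulr_gt0//; lra].
  have h7 := hCi w; have h8 := ln_eD_ge1 hX x0 w.
  have h9 : `|al w - ainf| <= Ci by apply: le_trans h7; exact: ler_peMr.
  have h10 : `|al w - ainf| * ln (2 * A) <= Ci * ln (2 * A) by exact: ler_wpM2r.
  have h11 : `|al w - ainf| * ln (1 + D) <=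
      `|al w - ainf| * (ln (2 * A) + ln (expR 1 + d w x0)) by exact: ler_wpM2l.
  rewrite mulrDr in h11; rewrite mulrDr; lra.
have lnD0 : 0 <= ln (1 + D) by rewrite ln_ge0// lerDl.
have h1 : del * ln (1 + D) <= 2 * Ci * (ln (2 * A) + 1).
  have hzz := hfar z hz; have hyy := hfar y hy.
  have : del * ln (1 + D) <= (`|al z - ainf| + `|al y - ainf|) * ln (1 + D).
    apply: ler_wpM2r => //; rewrite /del [X in _ <= _ + X]distrC.
    by apply: le_trans (ler_normD _ _); rewrite addrA subrK.
  rewrite mulrDl; lra.
have r10 : 0 <= r^-1 by rewrite invr_ge0 ltW.
have hsplit : ln (1 + (1 + D) / r) <= ln (1 + D) + ln (1 + r^-1).
  rewrite -lnM ?posrE; [|lra|lra].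
  have ? : 0 <= (1 + D) / r by rewrite mulr_ge0//; lra.
  rewrite ler_ln ?posrE; [|lra|by rewrite mulr_gt0//; lra].
  rewrite mulrDr mulr1; lra.
have h2 : del * ln (1 + r^-1) <= ln (1 + s0) + 4 * C0.
  have [hs|hs] := leP r^-1 s0.
    apply: (@le_trans _ _ (ln (1 + s0))); last lra.
    apply: (@le_trans _ _ (ln (1 + r^-1))).
      by apply: ler_piMl => //; rewrite ln_ge0// lerDl.
    by rewrite ler_ln ?posrE ?lerD2l//; lra.
  have hrs : s0 * r < 1 by rewrite -ltr_pdivlMr// mul1r.
  have hzy : d z y < M * r.
    have := hA z y x; rewrite (dC z x) => h.
    have : A * (d x z + d x y) < A * (K * r + K * r).
      by rewrite ltr_pM2l ?ltrD//; lra.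
    rewrite /M; lra.
  have hMr2 : (M * r) ^+ 2 <= r.
    rewrite exprMn expr2 [r ^+ 2]expr2 mulrA.
    apply: ler_piMl; first exact: ltW.
    rewrite -expr2; move: hrs; rewrite /s0.
    have : 0 <= M ^+ 2 * r by rewrite mulr_ge0 ?exprn_ge0 ?ltW//; lra.
    lra.
  have Mr0 : 0 < M * r by rewrite mulr_gt0//; lra.
  have Mr12 : M * r < 2^-1.
    have : M * 4 * r <= s0 * r.
      rewrite ler_pM2r// /s0 ler_pM2r// expr2; apply: ler_peMl; lra.
    lra.
  have [zy|nzy] := pselect (z = y).
    by rewrite /del zy subrr normr0 mul0r; lra.
  have d0 : 0 < d z y.
    rewrite lt_neqAle d_ge0 andbT eq_sym; apply/eqP.
    by move/(qm_eq0 (ht_quasi_metric hX)).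
  (* The factor 4 on [C0] arises as 2 times 2: [ln (1 + r^-1)] is at most twice [- ln r], itself at
     most twice [- ln (d z y)]. *)
  have g1 : ln (d z y) *+ 2 <= ln r.
    rewrite -lnXn// ler_ln ?posrE ?exprn_gt0//; apply: le_trans hMr2.
    by apply: lerXn2r; rewrite ?nnegrE; lra.
  have g2 : ln (1 + r^-1) <= - ln r *+ 2.
    rewrite -lnV ?posrE// -lnXn ?invr_gt0//
      ler_ln ?posrE ?exprn_gt0 ?invr_gt0//; last lra.
    rewrite expr2; have : 4 * r^-1 <= r^-1 * r^-1 by rewrite ler_wpM2r//; lra.
    lra.
  have g3 : del * - ln (d z y) <= C0 by apply: hC0; lra.
  have g4 : del * ln (1 + r^-1) <= del * (4 * - ln (d z y)).
    apply: ler_wpM2l => //; move: g1 g2; rewrite !mulr2n; lra.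
  rewrite mulrCA in g4; lra.
have h3 : del * ln (1 + (1 + D) / r) <= del * (ln (1 + D) + ln (1 + r^-1)).
  exact: ler_wpM2l.
rewrite mulrDr in h3; lra.
Qed.

(** The bound on [G * vol x r] and the polynomial lower bound on volumes give [ln G] at most a
    constant plus a multiple of the logarithm that [log_holder_osc] absorbs. *)
Lemma powR_osc K K1 : 1 <= K -> 1 <= K1 -> exists2 C : R, 1 <= C &
  forall (x z y : X) (r G : R), 0 < r -> d x z < K * r -> d x y < K * r ->
  1 <= G -> G * vol x r <= K1 -> G `^ al z <= C * G `^ al y.
Proof.
move=> hK hK1; have [c hc] := log_holder_osc K hK.
have [c1 [c2 [c10 c20 hv]]] := ln_qvol_ge hX x0.
have lK1 : 0 <= ln K1 by exact: ln_ge0.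
exists (expR (`|ln K1 + c1 + c2 * c|)); first by rewrite -expR0 ler_expR.
move=> x z y r G r0 hz hy G1 hG; have G0 : 0 < G by lra.
apply: (powR_shift G0); apply: le_trans (ler_norm _).
have v0 := qvol_gt0 hX r0 : 0 < vol x r.
have lnG : 0 <= ln G by exact: ln_ge0.
rewrite (ger0_norm lnG).
have lnG_le : ln G <= ln K1 + c1 + c2 * ln (1 + (1 + d x x0) / r).
  have := hv x r r0; have : ln G + ln (vol x r) <= ln K1.
    by rewrite -lnM// ler_ln ?posrE ?mulr_gt0//; lra.
  lra.
have h1 := hc x z y r r0 hz hy.
have del0 : 0 <= `|al z - al y| by exact: normr_ge0.
have del1 := dal_le1 z y.
apply: (le_trans (ler_wpM2l del0 lnG_le)).
rewrite mulrDr mulrCA; apply: lerD; last exact: ler_wpM2l.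
by apply: ler_piMl => //; lra.
Qed.

End LogHolder.

(** * A finite Vitali covering lemma *)

(** Balls are kept as center-radius pairs, since a set may not determine them. [trivIset] is blind
    to repetitions, which sums over the list would count; hence [uniq]. *)
Definition disjoint_balls {R : realType} {disp : measure_display}
    {X : measurableType disp} (d : X -> X -> R) (s : seq (X * R)) : Prop :=
  uniq s /\ trivIset [set` s] (fun b => qball d b.1 b.2).

Section FiniteVitali.
Context {R : realType} {disp : measure_display} {X : measurableType disp}.
Context {d : X -> X -> R} {mu : {measure set X -> \bar R}}.
Hypothesis hX : homogeneous_type d mu.
Local Notation ball b := (qball d b.1 b.2).

Lemma disjoint_balls_cons b s : 0 < b.2 -> disjoint_balls d s ->
  (forall c, c \in s -> ball b `&` ball c = set0) -> disjoint_balls d (b :: s).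
Proof.
move=> b0 [us ts] hb; split.
  rewrite /= us andbT; apply/negP => /hb; apply/eqP/set0P; exists b.1.
  by rewrite setIid; exact: (qball_center hX).
move=> i j /=; rewrite !inE => /orP[/eqP->|si] /orP[/eqP->|sj] // hne.
- by move/set0P/eqP: hne; rewrite hb.
- by move/set0P/eqP: hne; rewrite setIC hb.
- exact: ts.
Qed.

(** The supremum of the radii may not be attained, so maximality is only up to a factor 2. *)
Lemma exists_half_maximal (F : set (X * R)) (rmax : R) :
  (forall b, F b -> 0 < b.2 <= rmax) -> F !=set0 ->
  exists2 b, F b & forall c, F c -> c.2 <= 2 * b.2.
Proof.
move=> hF [b0 Fb0]; have /andP[b00 _] := hF _ Fb0.
pose E := [set b.2 | b in F].
have hE : has_sup E.
  split; first by exists b0.2, b0.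
  by exists rmax => _ [b /hF/andP[_ ?] <-].
have supE c : F c -> c.2 <= sup E by move=> Fc; apply: (ub_le_sup hE.2); exists c.
have s0 : 0 < sup E := lt_le_trans b00 (supE _ Fb0).
have [|_ [b Fb <-] hb] := sup_adherent (eps := sup E / 2) _ hE.
  by rewrite divr_gt0.
exists b => // c /supE; lra.
Qed.

(** Greedy selection: take a ball of almost maximal radius, discard those meeting it, and recurse on
    the bound [N] for the size of disjoint subfamilies. *)
Lemma finite_vitali : exists2 K : R, 1 <= K &
  forall (N : nat) (F : set (X * R)) (rmax : R),
    (forall b, F b -> 0 < b.2 <= rmax) ->
    (forall s, disjoint_balls d s -> (forall b, b \in s -> F b) -> (size s <= N)%N) ->
  exists s, [/\ disjoint_balls d s, (forall b, b \in s -> F b) &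
    forall b, F b -> exists2 c, c \in s & ball b `<=` qball d c.1 (K * c.2)].
Proof.
have [A A1 hA] := quasi_triangle hX.
have A0 : 0 < A by lra.
(* A discarded ball has radius at most twice that of [b], so its points are within [A * (4 * b.2)]
   of a common point; a second use of the triangle inequality gives this factor. *)
exists (A + 4 * A ^+ 2) => [|N].
  have : 0 <= A ^+ 2 by rewrite exprn_ge0// ltW.
  lra.
elim: N => [|N ih] F rmax hF hN.
  exists [::]; split=> // b Fb.
  have /andP[b0 _] := hF _ Fb.
  have ds : disjoint_balls d [:: b].
    by apply: disjoint_balls_cons => //; split=> // i j.
  suff : (size [:: b] <= 0)%N by [].
  by apply: (hN _ ds) => c; rewrite inE => /eqP->.
have [F0|/set0P F0] := eqVneq F set0.
  by exists [::]; split=> // b; rewrite F0.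
have [b Fb hb] := exists_half_maximal _ _ hF F0.
have /andP[b0 _] := hF _ Fb.
pose F' := [set c | F c /\ ball b `&` ball c = set0].
have [||s [ds sF' hs]] := ih F' rmax.
- by move=> c [/hF].
(* Prepending [b] to a disjoint list from [F'] gives one from [F], so the size bound drops by
   one. *)
- move=> s ds sF'; rewrite -ltnS; apply: (hN (b :: s)).
    by apply: disjoint_balls_cons => // c /sF'[].
  by move=> c; rewrite inE => /orP[/eqP->|/sF'[]].
exists (b :: s); split.
- by apply: disjoint_balls_cons => // c /sF'[].
- by move=> c; rewrite inE => /orP[/eqP->|/sF'[]].
move=> c Fc; have [bc|/eqP/set0P[w [bw cw]]] := pselect (ball b `&` ball c = set0).
  have [e es ce] := hs c (conj Fc bc).
  by exists e => //; rewrite inE es orbT.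
exists b; first by rewrite inE eqxx.
move=> y; rewrite /qball /= in bw cw * => cy.
have h1 := hA b.1 y w; have h2 := hA w y c.1.
rewrite (qm_sym (ht_quasi_metric hX) w c.1) in h2.
have h3 := hb _ Fc.
have h4 : A * (d c.1 w + d c.1 y) < A * (4 * b.2) by rewrite ltr_pM2l//; lra.
have h5 : A * (d b.1 w + d w y) < A * (b.2 + A * (4 * b.2)).
  by rewrite ltr_pM2l//; lra.
rewrite mulrDr mulrA in h5; rewrite mulrDl expr2; lra.
Qed.

End FiniteVitali.

(** The integral of a nonnegative function is a supremum over simple functions below it, so it is
    monotone without measurability. This handles level sets of the maximal function. *)
Lemma le_integral_nonmeasurable {R : realType} {disp : measure_display}
    {T : measurableType disp} (mu : {measure set T -> \bar R}) (D : set T)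
    (f g : T -> \bar R) :
  (forall x, D x -> 0 <= f x)%E -> (forall x, 0 <= g x)%E ->
  (forall x, D x -> f x <= g x)%E ->
  (\int[mu]_(x in D) f x <= \int[mu]_x g x)%E.
Proof.
move=> f0 g0 fg; rewrite integral_mkcond !ge0_integralTE//; last first.
  by move=> x; exact: erestrict_ge0.
apply: ereal_sup_le => _ /= [h hf <-]; exists h => // x.
apply: le_trans (hf x) _; rewrite patchE; case: ifPn => // /set_mem.
exact: fg.
Qed.

(** * Comparison of exponents over a ball *)

Section BallEstimate.
Context {R : realType} {disp : measure_display} {X : measurableType disp}.
Context {d : X -> X -> R} {mu : {measure set X -> \bar R}}.
Hypothesis hX : homogeneous_type d mu.
Local Notation vol := (qvol d mu).
Variables (x0 : X) (eta : R) (al : X -> R).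
Hypothesis eta_ge0 : 0 <= eta.
Hypothesis al_itv : forall x, eta <= al x <= 1.
Hypothesis al_LH0 : LH0 d al.
Hypothesis al_LHinf : LHinfty d x0 al.

Let al01 x : 0 <= al x <= 1.
Proof.
have /andP[h1 h2] := al_itv x; apply/andP; split; [exact: le_trans h1|exact: h2].
Qed.

(** For [M] between the weight and 1, [ln M] is at most [m] times [ln (e + d x x0)] in absolute
    value, which [LHinfty] absorbs. The shift [s] is used with the values 0 and [eta]. *)
Lemma powR_decay_shift m : exists (ainf C : R), [/\ eta <= ainf <= 1, 1 <= C &
  forall (x : X) (M s : R), decay d x0 m x <= M -> M <= 1 ->
  M `^ (al x - s) <= C * M `^ (ainf - s) /\
  M `^ (ainf - s) <= C * M `^ (al x - s)].
Proof.
have [ainf [C [h1 C0 hC]]] := LHinfty_mul_ln hX x0 al eta 1 al_itv al_LHinf.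
exists ainf, (expR (m%:R * C)); split=> //.
  by rewrite -expR0 ler_expR mulr_ge0.
move=> x M s hM M1; have M0 : 0 < M := lt_le_trans (decay_gt0 x0 m x) hM.
have lnM : `|ln M| <= m%:R * ln (expR 1 + d x x0).
  rewrite ler0_norm ?ln_le0// -lerN2 opprK -[leLHS]expRK -/(decay d x0 m x).
  by rewrite ler_ln ?posrE// decay_gt0.
have key : `|al x - ainf| * `|ln M| <= m%:R * C.
  apply: (le_trans (ler_wpM2l (normr_ge0 _) lnM)).
  by rewrite mulrCA ler_wpM2l.
split; apply: (powR_shift M0); last rewrite distrC;
  by rewrite opprB addrA subrK.
Qed.

(* Two regimes for [G], an average of [g] over the ball: where [G >= 1] the ball
   is small and [powR_osc] moves the exponent from [z] to [y]; where [G < 1]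
   both exponents are compared with the one at infinity, thanks to the decay
   weight bounding [g] from below. *)
Lemma exponent_comparison m K K1 : 1 <= K -> 1 <= K1 -> exists2 C : R, 1 <= C &
  forall (x y : X) (r G : R), 0 < r -> d x y < K * r -> 0 < G ->
  G * vol x r <= K1 -> eta <= 1 ->
  exists H : R, [/\ 0 <= H,
    forall z g, d x z < r -> decay d x0 m z <= g ->
      g `^ al z <= H * (1 + g / G) &
    vol x r `^ eta * H <= C * Num.max G (decay d x0 m y) `^ (al y - eta)].
Proof.
move=> hK hK1.
have [ainf [Cd [/andP[ainf_eta ainf1] Cd1 hCd]]] := powR_decay_shift m.
have [Co Co1 hCo] := powR_osc hX x0 al al01 al_LH0 al_LHinf K K1 hK hK1.
have ainf0 : 0 <= ainf := le_trans eta_ge0 ainf_eta.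
have Cd0 : 0 <= Cd by lra.
have Co0 : 0 <= Co by lra.
have K10 : 0 <= K1 by lra.
have CdK : 1 <= Cd * Cd * K1.
  by rewrite -[leLHS]mulr1 ler_pM// -[leLHS]mulr1 ler_pM.
have CoK : 0 <= Co * K1 by rewrite mulr_ge0.
exists (Cd * Cd * K1 + Co * K1); first lra.
move=> x y r G r0 hy G0 hG eta1.
have v0 : 0 < vol x r := qvol_gt0 hX r0.
have /andP[aly aly1] := al_itv y.
set Sy := decay d x0 m y; set M := Num.max G Sy.
have GM : G <= M by rewrite le_max lexx.
have SM : Sy <= M by rewrite le_max lexx orbT.
have M0 : 0 <= M by lra.
(* The fractional factor is traded for a power of [G]: the product of [vol x r] and [G] is at most
   [K1], and its power [eta <= 1] is still at most [K1]. *)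
have Kle w : vol x r `^ eta * G `^ w <= K1 * G `^ (w - eta).
  have -> : G `^ w = G `^ eta * G `^ (w - eta).
    by rewrite -powRD ?[_ + (w - _)]addrC ?subrK// lt0r_neq0 ?implybT.
  rewrite mulrA ler_wpM2r ?powR_ge0// -powRM ?(ltW v0) ?(ltW G0)//.
  apply: (@le_trans _ _ (K1 `^ eta)).
    apply: ge0_ler_powR => //; rewrite ?nnegrE//; last by rewrite mulrC.
    by rewrite mulr_ge0 ?(ltW v0) ?(ltW G0).
  exact: ler1_powR.
have GMw w : 0 <= w -> G `^ w <= M `^ w.
  by move=> w0; apply: ge0_ler_powR => //; rewrite nnegrE// ltW.
have [G1|G1] := leP 1 G.
- exists (Co * G `^ al y); split.
  + by rewrite mulr_ge0 ?powR_ge0.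
  + move=> z g hz hg; have /andP[alz0 alz1] := al01 z.
    have g0 : 0 < g := lt_le_trans (decay_gt0 x0 m z) hg.
    apply: (le_trans (powR_le_mul_ratio G0 (ltW g0) (al01 z))).
    apply: ler_wpM2r; first by rewrite addr_ge0 ?divr_ge0 ?(ltW g0) ?(ltW G0).
    apply: (hCo x z y r G) => //; apply: (lt_le_trans hz).
    by rewrite ler_peMl// ltW.
  rewrite mulrCA; apply: (@le_trans _ _ (Co * (K1 * M `^ (al y - eta)))).
    apply: ler_wpM2l => //; apply: (le_trans (Kle _)).
    by apply: ler_wpM2l => //; apply: GMw; lra.
  by rewrite mulrA ler_wpM2r ?powR_ge0// lerDr; lra.
exists (Cd * G `^ ainf); split.
- by rewrite mulr_ge0 ?powR_ge0.
- move=> z g hz hg; have /andP[alz0 alz1] := al01 z.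
  have g0 : 0 < g := lt_le_trans (decay_gt0 x0 m z) hg.
  have gG0 : 0 <= g / G by rewrite divr_ge0 ?(ltW g0) ?(ltW G0).
  (* The exponent at infinity is available only for [g <= 1]. For larger [g], the power is at most
     [g = G * (g / G)], and [G < 1] is at most its power [ainf]. *)
  rewrite -mulrA; have [g1|g1] := leP g 1.
    have [] := hCd z g 0 hg g1; rewrite !subr0 => hg1 _.
    apply: (le_trans hg1); apply: ler_wpM2l => //.
    by apply: powR_le_mul_ratio => //; [exact: ltW|apply/andP; split; lra].
  apply: (@le_trans _ _ g); first by apply: ler1_powR; lra.
  apply: (@le_trans _ _ (G `^ ainf * (1 + g / G))); last first.
    by apply: ler_peMl => //; rewrite mulr_ge0 ?powR_ge0// addr_ge0.
  apply: (@le_trans _ _ (G * (g / G))); first by rewrite mulrC divfK// lt0r_neq0.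
  apply: ler_pM => //; [exact: ltW| |by rewrite lerDr].
  by apply: ger1_powR => //; rewrite G0 ltW.
rewrite mulrCA.
have S1 : Sy <= 1 := decay_le1 hX x0 m y.
have M1 : M <= 1 by rewrite ge_max (ltW G1).
(* Taking the maximum with the weight at [y] puts [M] in the range where the exponent at infinity
   can be turned back into [al y]. *)
have [_ hM] := hCd y M eta SM M1.
apply: (@le_trans _ _ (Cd * (K1 * (Cd * M `^ (al y - eta))))).
  apply: ler_wpM2l => //; apply: (le_trans (Kle _)).
  apply: ler_wpM2l => //; apply: le_trans hM.
  by apply: GMw; lra.
rewrite [K1 * _]mulrCA !mulrA ler_wpM2r ?powR_ge0//.
lra.
Qed.

End BallEstimate.

(** * Bounds for fractional means *)

Definition qmean {R : realType} {disp : measure_display}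
    {X : measurableType disp} (d : X -> X -> R)
    (mu : {measure set X -> \bar R}) (g : X -> R) (x : X) (r : R) : R :=
  fine (\int[mu]_(z in qball d x r) (g z)%:E) / qvol d mu x r.

Definition frac_mean {R : realType} {disp : measure_display}
    {X : measurableType disp} (mu : {measure set X -> \bar R})
    (eta : R) (f : X -> R) (B : set X) : \bar R :=
  (mu B `^ eta * ((mu B)^-1 * \int[mu]_(y in B) `|f y|%:E))%E.

Section FractionalMean.
Context {R : realType} {disp : measure_display} {X : measurableType disp}.
Context {d : X -> X -> R} {mu : {measure set X -> \bar R}}.
Hypothesis hX : homogeneous_type d mu.
Local Notation vol := (qvol d mu).
Variables (x0 : X) (eta : R) (al : X -> R).
Hypothesis eta_ge0 : 0 <= eta.
Hypothesis al_itv : forall x, eta <= al x <= 1.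
Hypothesis al_LH0 : LH0 d al.
Hypothesis al_LHinf : LHinfty d x0 al.

(** A zero integral would make [g] vanish almost everywhere on a ball, which has positive
    measure. *)
Lemma integral_qball_gt0 (g : X -> R) x r : 0 < r -> measurable_fun [set: X] g ->
  (forall z, 0 < g z) -> (0 < \int[mu]_(z in qball d x r) (g z)%:E)%E.
Proof.
move=> r0 mg g0; have mB := measurable_qball hX x r.
have mgB : measurable_fun (qball d x r) (EFin \o g).
  by apply/measurable_EFinP; apply: measurable_funTS.
rewrite lt0e integral_ge0 ?andbT; last by move=> z _; rewrite lee_fin ltW.
apply/eqP => h.
have : (\int[mu]_(z in qball d x r) `|(EFin \o g) z| = 0)%E.
  rewrite -[RHS]h; apply: eq_integral => z _ /=.
  by rewrite ger0_norm// ltW.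
move/(ae_eq_integral_abs mu mB mgB) => [N [mN muN hN]].
have : (mu (qball d x r) <= mu N)%E.
  apply: le_measure; rewrite ?inE// => z Bz; apply: hN => /= /(_ Bz) [].
  by apply/eqP; rewrite gt_eqF.
by rewrite muN leNgt (ht_ball_gt0 hX).
Qed.

(** Integrates the pointwise bound of [exponent_comparison] over the ball, with [G] the mean of [g]:
    the average of [1 + g / G] is 2, whence the constant [C * 2]. *)
Lemma frac_mean_bound m K K1 : 1 <= K -> 1 <= K1 -> exists2 C : R, 1 <= C &
  forall f g : X -> R, measurable_fun [set: X] f -> measurable_fun [set: X] g ->
  (forall z, decay d x0 m z <= g z) ->
  (\int[mu]_z (g z)%:E <= K1%:E)%E ->
  {ae mu, forall z, `|f z| <= g z `^ al z} ->
  forall x y r, 0 < r -> d x y < K * r ->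
  (frac_mean mu eta f (qball d x r) <=
    (C * Num.max (qmean d mu g x r) (decay d x0 m y) `^ (al y - eta))%:E)%E.
Proof.
move=> hK hK1.
have [C C1 hC] :=
  exponent_comparison hX x0 eta al eta_ge0 al_itv al_LH0 al_LHinf m K K1 hK hK1.
exists (C * 2); first lra.
move=> f g mf mg hg ig hfg x y r r0 hy.
have eta1 : eta <= 1 by have /andP[h1 h2] := al_itv x; exact: le_trans h1 h2.
have g0 z : 0 < g z := lt_le_trans (decay_gt0 x0 m z) (hg z).
have mB := measurable_qball hX x r; set B := qball d x r in mB *.
have v0 : 0 < vol x r := qvol_gt0 hX r0.
have muB : mu B = (vol x r)%:E := qvolE hX r0.
have mgT : measurable_fun [set: X] (EFin \o g) by apply/measurable_EFinP.
have mgB : measurable_fun B (EFin \o g) by exact: measurable_funTS.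
have iB0 : (0 < \int[mu]_(z in B) (g z)%:E)%E by exact: integral_qball_gt0.
have iBK : (\int[mu]_(z in B) (g z)%:E <= K1%:E)%E.
  apply: le_trans ig; apply: ge0_subset_integral => // z _.
  by rewrite lee_fin ltW.
set I := fine (\int[mu]_(z in B) (g z)%:E)%E.
have IE : (\int[mu]_(z in B) (g z)%:E = I%:E)%E.
  by rewrite /I fineK// ge0_fin_numE ?(ltW iB0)// (le_lt_trans iBK) ?ltry.
have I0 : 0 < I by rewrite -lte_fin -IE.
have IK : I <= K1 by rewrite -lee_fin -IE.
set G := qmean d mu g x r; have GE : G = I / vol x r by [].
have G0 : 0 < G by rewrite GE divr_gt0.
have Gv : G * vol x r = I by rewrite GE divfK// lt0r_neq0.
have GvK : G * vol x r <= K1 by rewrite Gv.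
have [H [H0 hH1 hH2]] := hC x y r G r0 hy G0 GvK eta1.
have mfB : measurable_fun B (fun z => `|f z|%:E).
  by apply/measurable_EFinP; apply: measurableT_comp => //; exact: measurable_funTS.
have p0 z : (0 <= G^-1%:E * (g z)%:E)%E.
  by apply: mule_ge0; rewrite lee_fin ?invr_ge0 ltW.
have s0 z : (0 <= 1%:E + G^-1%:E * (g z)%:E)%E.
  by apply: adde_ge0; rewrite ?p0// lee_fin.
have key : (\int[mu]_(z in B) `|f z|%:E <= (2 * H * vol x r)%:E)%E.
  apply: (@le_trans _ _ (\int[mu]_(z in B) (H%:E * (1%:E + G^-1%:E * (g z)%:E)))%E).
    apply: ae_ge0_le_integral => //.
    - by move=> z _; apply: mule_ge0; [rewrite lee_fin|exact: s0].
    - apply: measurable_funeM; apply: emeasurable_funD => //.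
      exact: measurable_funeM.
    apply: filterS hfg => z hz Bz.
    have -> : (H%:E * (1%:E + G^-1%:E * (g z)%:E) = (H * (1 + g z / G))%:E)%E.
      by rewrite [g z / G]mulrC.
    by rewrite lee_fin; apply: le_trans hz _; apply: hH1.
  rewrite ge0_integralZl_EFin//; last first.
    by apply: emeasurable_funD => //; exact: measurable_funeM.
  rewrite ge0_integralD//; last first.
    exact: measurable_funeM.
  rewrite (integral_cst mu mB 1%:E) mul1e ge0_integralZl_EFin//; last 2 first.
  - by move=> z _; rewrite lee_fin ltW.
  - by rewrite invr_ge0 ltW.
  rewrite IE muB.
  have <- : H * (vol x r + G^-1 * I) = 2 * H * vol x r.
    by rewrite GE invf_div divfK ?lt0r_neq0//; ring.
  exact: lexx.
rewrite /frac_mean muB poweR_EFin inver gt_eqF//.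
apply: (@le_trans _ _ ((vol x r `^ eta)%:E * ((vol x r)^-1%:E * (2 * H * vol x r)%:E))%E).
  by rewrite !lee_pmul2l// lte_fin ?powR_gt0// invr_gt0.
rewrite -!EFinM lee_fin.
rewrite [2 * H * _]mulrC mulKf ?lt0r_neq0// mulrCA [C * 2]mulrC -mulrA.
by rewrite ler_pM2l.
Qed.

End FractionalMean.

(** * Packing of disjoint balls and lower limits *)

Section WeakType.
Context {R : realType} {disp : measure_display} {X : measurableType disp}.
Context {d : X -> X -> R} {mu : {measure set X -> \bar R}}.
Hypothesis hX : homogeneous_type d mu.
Local Notation vol := (qvol d mu).
Local Notation ball b := (qball d b.1 b.2).

Lemma sum_integral_disjoint_balls (s : seq (X * R)) (D : set X) (h : X -> \bar R) :
  disjoint_balls d s -> measurable D -> (forall b, b \in s -> ball b `<=` D) ->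
  measurable_fun [set: X] h -> (forall x, 0 <= h x)%E ->
  (\sum_(b <- s) \int[mu]_(x in ball b) h x <= \int[mu]_(x in D) h x)%E.
Proof.
move=> [us ts] mD sD mh h0.
have mb (b : X * R) : measurable (ball b) by exact: (measurable_qball hX).
rewrite -(@ge0_integral_bigsetU _ _ _ mu _ (fun b : X * R => ball b))//;
  last exact: measurable_funTS.
apply: ge0_subset_integral => //.
- by apply: bigsetU_measurable => b _; exact: mb.
- exact: measurable_funTS.
by rewrite big_seq_cond; elim/big_ind : _ => // [A B ? ? x [|]|b /andP[/sD]]; auto.
Qed.

Lemma size_disjoint_balls (s : seq (X * R)) (D : set X) (delta V : R) :
  disjoint_balls d s -> measurable D -> (mu D <= V%:E)%E ->
  (forall b, b \in s -> [/\ 0 < b.2, ball b `<=` D & delta <= vol b.1 b.2]) ->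
  (size s)%:R * delta <= V.
Proof.
move=> ds mD muD hs.
have h1 : (\sum_(b <- s) \int[mu]_(x in ball b) 1%:E <= mu D)%E.
  have := sum_integral_disjoint_balls s D (cst 1%:E) ds mD.
  rewrite (integral_cst mu mD 1%:E) mul1e; apply => // b bs.
  by have [] := hs _ bs.
have h2 : (\sum_(b <- s) \int[mu]_(x in ball b) 1%:E =
    (\sum_(b <- s) vol b.1 b.2)%:E)%E.
  rewrite -sumEFin; apply: eq_big_seq => b bs; have [b0 _ _] := hs _ bs.
  by rewrite (integral_cst mu _ 1%:E) ?mul1e ?(qvolE hX b0)//;
    exact: (measurable_qball hX).
have h3 : (size s)%:R * delta <= \sum_(b <- s) vol b.1 b.2.
  have <- : \sum_(b <- s) delta = (size s)%:R * delta.
    by rewrite big_const_seq count_predT iter_addr_0 mulr_natl.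
  rewrite big_seq [leRHS]big_seq; apply: ler_sum => b bs.
  by have [_ _] := hs _ bs.
apply: (le_trans h3); rewrite -lee_fin -h2; exact: le_trans muD.
Qed.

Lemma le_limn_einf (u : (\bar R)^nat) (a : \bar R) (N : nat) :
  (forall n, (N <= n)%N -> a <= u n)%E -> (a <= limn_einf u)%E.
Proof.
move=> h; rewrite limn_einf_lim; apply: lime_ge; first exact: is_cvg_einfs.
near=> n; apply: le_ereal_inf_tmp => _ [k /= nk <-]; apply: h.
by apply: leq_trans nk; near: n; exact: nbhs_infty_ge.
Unshelve. all: by end_near. Qed.

Lemma limn_einf_le (u : (\bar R)^nat) (a : \bar R) :
  (forall n, u n <= a)%E -> (limn_einf u <= a)%E.
Proof.
move=> h; rewrite limn_einf_lim; apply: lime_le; first exact: is_cvg_einfs.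
apply: nearW => n; apply: le_trans (h n).
by apply: ereal_inf_lbound; exists n => /=.
Qed.

Lemma measurable_fun_limn_einf (u : (X -> \bar R)^nat) :
  (forall n, measurable_fun [set: X] (u n)) ->
  measurable_fun [set: X] (fun x => limn_einf (u ^~ x)).
Proof.
move=> mu_; apply: measurableT_comp => //.
apply: (measurable_fun_limn_esup (f := fun n => \- u n)%E) => n.
exact: measurableT_comp.
Qed.

End WeakType.

(** * Covering the level set and its majorant *)

Section WeakTypeEstimate.
Context {R : realType} {disp : measure_display} {X : measurableType disp}.
Context {d : X -> X -> R} {mu : {measure set X -> \bar R}}.
Hypothesis hX : homogeneous_type d mu.
Local Notation vol := (qvol d mu).
Local Notation ball b := (qball d b.1 b.2).
Variables (x0 : X) (eta : R) (al : X -> R).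
Hypothesis eta_ge0 : 0 <= eta.
Hypothesis al_itv : forall x, eta <= al x <= 1.
Hypothesis al_LH0 : LH0 d al.
Hypothesis al_LHinf : LHinfty d x0 al.

(* The restrictions on [b] make disjoint subfamilies finite and radii bounded. *)
Definition heavy_balls (f : X -> R) (t : R) (n : nat) : set (X * R) :=
  [set b | [/\ 0 < b.2 <= n.+1%:R, ball b `<=` qball d x0 n.+1%:R,
     n.+1%:R^-1 <= vol b.1 b.2 & (t%:E < frac_mean mu eta f (ball b))%E]].

(** Each truncation is met once [n] is large in terms of one ball witnessing the supremum; [N]
    depends on [y], which a lower limit tolerates. *)
Lemma frac_maximal_heavy f t y : (t%:E < frac_maximal d mu eta f y)%E ->
  exists N : nat, forall n, (N <= n)%N -> exists2 b, heavy_balls f t n b & ball b y.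
Proof.
move=> /ereal_sup_gt[_ [B [[c [r [r0 BE]]] By] <-] htB].
have [A A1 hA] := quasi_triangle hX.
have v0 : 0 < vol c r := qvol_gt0 hX r0.
have [N hN] : exists N : nat, Num.max (A * (d x0 c + r)) (Num.max r (vol c r)^-1) < N%:R.
  by exists (Num.bound (Num.max (A * (d x0 c + r)) (Num.max r (vol c r)^-1)));
    apply: archi_boundP; rewrite !le_max (ltW r0) orbT.
move: hN; rewrite !gt_max => /and3P[N1 N2 N3].
exists N => n Nn; have NnR : (N%:R : R) <= n.+1%:R by rewrite ler_nat ltnW.
exists (c, r); last by rewrite -BE.
split => /=.
- by rewrite r0 /=; lra.
- move=> w; rewrite /qball /= => hw.
  have h1 := hA x0 w c.
  have : A * (d x0 c + d c w) < A * (d x0 c + r) by rewrite ltr_pM2l ?ltrD2l//; lra.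
  lra.
- rewrite -[leRHS]invrK lef_pV2 ?posrE ?invr_gt0// ?ltr0n//; lra.
by rewrite /frac_mean -BE.
Qed.

(** Heavy balls have volume at least [n.+1%:R^-1] inside a ball of volume [V], so disjoint lists
    have bounded length. [K] does not depend on [f], [t] or [n]. *)
Lemma exists_vitali_heavy : exists2 K : R, 1 <= K &
  forall f t n, exists s, [/\ disjoint_balls d s,
    (forall b, b \in s -> heavy_balls f t n b) &
    forall b, heavy_balls f t n b ->
      exists2 c, c \in s & ball b `<=` qball d c.1 (K * c.2)].
Proof.
have [K K1 hK] := finite_vitali hX; exists K => // f t n.
pose V := vol x0 n.+1%:R.
have n0 : (0 : R) < n.+1%:R by [].
have V0 : 0 < V := qvol_gt0 hX n0.
apply: (hK (Num.bound (n.+1%:R * V)) (heavy_balls f t n) n.+1%:R).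
  by move=> b [].
move=> s ds hs; rewrite -(ler_nat R).
have h : (size s)%:R * n.+1%:R^-1 <= V.
  apply: (size_disjoint_balls hX s (qball d x0 n.+1%:R)) => //.
  - exact: (measurable_qball hX).
  - by rewrite (qvolE hX n0).
  by move=> b /hs[/andP[? ?] ? ? ?].
rewrite ler_pdivrMr// mulrC in h; apply: (le_trans h); apply: ltW.
by apply: archi_boundP; rewrite mulr_ge0// ltW.
Qed.

(** [u] is a measurable stand-in for the level set. The case [al y = eta] corresponds to an infinite
    conjugate exponent, where the conclusion bounds [t] itself. *)
Lemma weak_type_majorant m K1 : 1 <= K1 -> exists C Kf : R, [/\ 1 <= C, 1 <= Kf &
  forall f g : X -> R, measurable_fun [set: X] f -> measurable_fun [set: X] g ->
  (forall z, decay d x0 m z <= g z) ->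
  (\int[mu]_z (g z)%:E <= K1%:E)%E ->
  {ae mu, forall z, `|f z| <= g z `^ al z} ->
  forall t, 0 < t -> exists u : X -> \bar R,
  [/\ measurable_fun [set: X] u, (forall y, 0 <= u y)%E,
    (\int[mu]_y u y <= Kf%:E)%E &
    forall y, (t%:E < frac_maximal d mu eta f y)%E ->
      (al y = eta -> t <= C) /\
      (eta < al y -> (((t / C) `^ (al y - eta)^-1)%:E <= u y)%E)]].
Proof.
move=> hK1; have [K hK hV] := exists_vitali_heavy.
have [C C1 hC] :=
  frac_mean_bound hX x0 eta al eta_ge0 al_itv al_LH0 al_LHinf m K K1 hK hK1.
have [Cd Cd1 hCd] := qvol_dilate hX K hK.
(* The first term pays for the means of [g] spread over dilated balls, the second for the weight
   [S <= g]. *)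
exists C, (Cd * K1 + K1); split=> //.
  have : 0 <= Cd * K1 by rewrite mulr_ge0//; lra.
  lra.
move=> f g mf mg hg ig hfg t t0.
have {}hC := hC f g mf mg hg ig hfg.
have g0 z : 0 < g z := lt_le_trans (decay_gt0 x0 m z) (hg z).
have [s hs] := choice (hV f t).
pose S x := decay d x0 m x.
have S0 x : 0 < S x := decay_gt0 x0 m x.
have mS : measurable_fun [set: X] S := measurable_decay hX x0 m.
have mgT : measurable_fun [set: X] (EFin \o g) by apply/measurable_EFinP.
have mb x r : measurable (qball d x r) := measurable_qball hX x r.
pose G (b : X * R) := qmean d mu g b.1 b.2.
have G0 b : 0 <= G b.
  apply: divr_ge0; last by apply: fine_ge0; exact: measure_ge0.
  by apply: fine_ge0; apply: integral_ge0 => z _; rewrite lee_fin ltW.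
pose h (b : X * R) x := ((G b)%:E * (\1_(qball d b.1 (K * b.2)) x)%:E)%E.
have h0 b x : (0 <= h b x)%E by rewrite mule_ge0 ?lee_fin.
have mh b : measurable_fun [set: X] (h b).
  by apply: measurable_funeM; apply/measurable_EFinP.
pose u n x := (\sum_(b <- s n) h b x + (S x)%:E)%E.
have sum0 n x : (0 <= \sum_(b <- s n) h b x)%E by apply: sume_ge0.
have msum n : measurable_fun [set: X] (fun x => \sum_(b <- s n) h b x)%E.
  exact: emeasurable_sum.
have mSe : measurable_fun [set: X] (fun x => (S x)%:E) by apply/measurable_EFinP.
have u0 n x : (0 <= u n x)%E by rewrite adde_ge0// lee_fin ltW.
have mu_ n : measurable_fun [set: X] (u n) by exact: emeasurable_funD.
have iS : (\int[mu]_x (S x)%:E <= K1%:E)%E.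
  apply: le_trans ig; apply: ge0_le_integral => // x _; rewrite lee_fin.
    exact: ltW.
  exact: hg.
have iu n : (\int[mu]_x u n x <= (Cd * K1 + K1)%:E)%E.
  have [ds sF _] := hs n.
  rewrite ge0_integralD//; last by move=> x _; rewrite lee_fin ltW.
  rewrite EFinD; apply: leeD => //.
  rewrite ge0_integral_sum//.
  apply: (@le_trans _ _ (\sum_(b <- s n) Cd%:E * \int[mu]_(x in ball b) (g x)%:E)%E).
    rewrite big_seq [leRHS]big_seq; apply: lee_sum => b bs.
    have [/andP[b0 _] _ _ _] := sF _ bs.
    have Kb0 : 0 < K * b.2 by rewrite mulr_gt0//; lra.
    have v0 : 0 < vol b.1 b.2 := qvol_gt0 hX b0.
    rewrite /h ge0_integralZl_EFin//; last by apply/measurable_EFinP.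
    rewrite integral_indic// setIT (qvolE hX Kb0).
    have IE : ((fine (\int[mu]_(x in ball b) (g x)%:E))%:E =
        \int[mu]_(x in ball b) (g x)%:E)%E.
      rewrite fineK// ge0_fin_numE; last first.
        by apply: integral_ge0 => z _; rewrite lee_fin ltW.
      apply: (@le_lt_trans _ _ K1%:E); last exact: ltry.
      apply: le_trans ig; apply: ge0_subset_integral => //.
      by move=> z _; rewrite lee_fin ltW.
    rewrite -IE -!EFinM lee_fin.
    (* Dilating costs [Cd], and [G b] times the volume of the undilated ball is the integral of [g]
       there; disjointness then sums these integrals. *)
    apply: (le_trans (ler_wpM2l (G0 b) (hCd _ _ b0))).
    by rewrite mulrCA /G /qmean divfK ?lexx// lt0r_neq0.
  rewrite -ge0_sume_distrr; last first.
    by move=> b _; apply: integral_ge0 => z _; rewrite lee_fin ltW.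
  rewrite EFinM; apply: lee_wpmul2l; first by rewrite lee_fin; lra.
  apply: le_trans (ig); apply: sum_integral_disjoint_balls => //.
  by move=> x; rewrite lee_fin ltW.
exists (fun x => limn_einf (u ^~ x)); split.
- exact: measurable_fun_limn_einf.
- by move=> y; apply: (le_limn_einf _ _ 0%N).
- apply: (le_trans (fatou mu measurableT mu_ (fun n x _ => u0 n x))).
  exact: limn_einf_le.
move=> y /frac_maximal_heavy[N hN].
have key n : (N <= n)%N -> exists w : R,
    [/\ 0 < w, t <= C * w `^ (al y - eta) & (w%:E <= u n y)%E].
  move=> Nn; have [b hb yb] := hN n Nn; have [ds sF sc] := hs n.
  (* The estimate is applied to the selected ball [c], whose own mean exceeds [t], at the point [y]
     of its dilate. *)
  have [c cs bc] := sc _ hb; have yc := bc _ yb.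
  have [/andP[c0 _] _ _ tc] := sF _ cs.
  have hw := hC c.1 y c.2 c0 yc.
  exists (Num.max (G c) (S y)); split.
  - by rewrite lt_max S0 orbT.
  - by rewrite -lee_fin; apply: le_trans hw; exact: ltW.
  apply: (@le_trans _ _ (G c + S y)%:E).
    by rewrite lee_fin ge_max lerDl (ltW (S0 y)) lerDr G0.
  rewrite EFinD; apply: leeD => //.
  rewrite (big_rem c)//=; apply: (@le_trans _ _ (h c y)).
    by rewrite /h indicE mem_set// mule1.
  by apply: leeDl; exact: sume_ge0.
have C0 : 0 < C by lra.
split=> hal.
  have [w [w0 + _]] := key N (leqnn N).
  by rewrite hal subrr powRr0 mulr1.
apply: (le_limn_einf _ _ N) => n Nn; have [w [w0 hw wu]] := key n Nn.
apply: le_trans wu; rewrite lee_fin.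
have be0 : 0 < al y - eta by rewrite subr_gt0.
have hw2 : t / C <= w `^ (al y - eta) by rewrite ler_pdivrMr// mulrC.
apply: (@le_trans _ _ ((w `^ (al y - eta)) `^ (al y - eta)^-1)).
  apply: ge0_ler_powR => //; rewrite ?nnegrE ?powR_ge0// ?invr_ge0 ?ltW//.
  by rewrite divr_gt0.
by rewrite -powRrM mulfV ?lt0r_neq0// powRr1// ltW.
Qed.

End WeakTypeEstimate.

(** * Bounded spaces and the inverse exponent *)

Section InverseExponent.
Context {R : realType} {disp : measure_display} {X : measurableType disp}.
Context {d : X -> X -> R} {mu : {measure set X -> \bar R}}.
Hypothesis hX : homogeneous_type d mu.
Local Notation vol := (qvol d mu).

(* An unbounded space contains far away balls of volume bounded below, disjoint
   from any given ball around [x0]. *)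
Lemma finite_measure_bounded (x0 : X) : (mu [set: X] < +oo)%E ->
  exists D : R, forall x, d x x0 <= D.
Proof.
move=> muX; apply: contrapT => unb.
have far (r : R) : exists x, r < d x x0.
  apply: contrapT => h; apply: unb; exists r => x; rewrite leNgt; apply/negP => hx.
  by apply: h; exists x.
have [A A1 hA] := quasi_triangle hX.
have A21 : 1 <= A ^+ 2 by exact: exprn_ege1.
(* A far ball of radius [s = d x x0 / (2 * A)], dilated by this factor, contains the unit ball at
   [x0]; so its volume is at least [c]. *)
have [|C C1 hC] := qvol_dilate hX (4 * A ^+ 2); first lra.
have v1 : 0 < vol x0 1 := qvol_gt0 hX ltr01.
pose c := vol x0 1 / C; have C0 : 0 < C by lra.
have c0 : 0 < c by rewrite divr_gt0.
have mb x r : measurable (qball d x r) := measurable_qball hX x r.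
have grow k : exists2 r, 0 < r & k%:R * c <= vol x0 r.
  elim: k => [|k [r r0 hr]].
    by exists 1 => //; rewrite mul0r ltW.
  have [x hx] := far (1 + 2 * A * r).
  (* A point common to the two balls, both of radius at most [s], would give [d x x0 < A * (s + s)],
     that is, [d x x0 < d x x0]. *)
  pose s := d x x0 / (2 * A).
  have A20 : 0 < 2 * A by lra.
  have Ar0 : 0 < A * r by rewrite mulr_gt0//; lra.
  have dx : d x x0 = 2 * A * s by rewrite /s mulrC divfK// lt0r_neq0.
  have s0 : 0 < s by rewrite divr_gt0//; lra.
  have rs : r < s by rewrite -(ltr_pM2l A20) -dx; lra.
  pose r' := A * (d x x0 + s) + s.
  have As0 : 0 < A * (d x x0 + s) by rewrite mulr_gt0 ?addr_gt0//; lra.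
  have r'0 : 0 < r' by rewrite /r'; lra.
  exists r' => //.
  have sub1 : qball d x0 r `<=` qball d x0 r'.
    by apply: (sub_qball (d := d)); rewrite /r'; lra.
  have sub2 : qball d x s `<=` qball d x0 r'.
    move=> w; rewrite /qball /= => hw; have h1 := hA x0 w x.
    rewrite (qm_sym (ht_quasi_metric hX) x0 x) in h1.
    have : A * (d x x0 + d x w) < A * (d x x0 + s) by rewrite ltr_pM2l ?ltrD2l//; lra.
    rewrite /r'; lra.
  have dis : qball d x0 r `&` qball d x s = set0.
    apply/seteqP; split => // w [] /=; rewrite /qball /= => w1 w2.
    have h1 := hA x x0 w; rewrite (qm_sym (ht_quasi_metric hX) w x0) in h1.
    have : A * (d x w + d x0 w) < A * (s + s) by rewrite ltr_pM2l ?ltrD//; lra.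
    rewrite dx in h1; lra.
  have cs : c <= vol x s.
    rewrite ler_pdivrMr// mulrC; apply: le_trans (hC x s s0).
    apply: (le_qvol hX) => //; first by rewrite mulr_gt0//; lra.
    move=> w; rewrite /qball /= => hw; have h1 := hA x w x0.
    have h2 : A * (d x x0 + d x0 w) < A * (d x x0 + d x x0).
      by rewrite ltr_pM2l ?ltrD2l//; lra.
    have h3 : A * (d x x0 + d x x0) = 4 * A ^+ 2 * s by rewrite dx; ring.
    lra.
  have h : vol x0 r + vol x s <= vol x0 r'.
    rewrite -lee_fin EFinD -!(qvolE hX)// -measureU//.
    apply: le_measure; rewrite ?inE//; first exact: measurableU.
    by move=> w [/sub1|/sub2].
  rewrite -natr1 mulrDl mul1r; lra.
pose V := fine (mu [set: X]).
have VE : mu [set: X] = V%:E by rewrite /V fineK// ge0_fin_numE.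
have V0 : 0 <= V by rewrite -lee_fin -VE.
have [r r0] := grow (Num.bound (V / c)).
have : vol x0 r <= V.
  rewrite -lee_fin -(qvolE hX)// -VE.
  by apply: le_measure; rewrite ?inE.
have := archi_boundP (divr_ge0 V0 (ltW c0)).
rewrite ltr_pdivrMr//; lra.
Qed.

Lemma LHinfty_bounded (x0 : X) (D : R) (al : X -> R) : (forall x, d x x0 <= D) ->
  (forall x, 0 <= al x <= 1) -> LHinfty d x0 al.
Proof.
move=> hD al01; exists (ln (expR 1 + D)), 0 => x.
have /andP[al0 al1] := al01 x; rewrite subr0 ger0_norm//.
have h1 := ln_eD_ge1 hX x0 x; have d0 := qm_ge0 (ht_quasi_metric hX) x x0.
have e0 := @expR_gt0 R 1; have hDx := hD x.
apply: (le_trans al1); rewrite ler_pdivlMr ?mul1r; last lra.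
by rewrite ler_ln ?posrE ?lerD2l//; lra.
Qed.

Variable p : X -> \bar R.
Hypothesis p_ge1 : forall x, (1 <= p x)%E.
Local Notation al := (inv_exponent p).

Lemma inv_exponentE x : (p x)^-1%E = (al x)%:E.
Proof.
rewrite /inv_exponent; have := p_ge1 x.
case: (p x) => [r|_|//]; last by rewrite invey.
rewrite lee_fin => r1; rewrite inver gt_eqF//; lra.
Qed.

Lemma inv_exponent01 x : 0 <= al x <= 1.
Proof.
rewrite /inv_exponent; have := p_ge1 x.
case: (p x) => [r|_|//]; last by rewrite invey /= lexx ler01.
rewrite lee_fin => r1; rewrite inver gt_eqF /=; last lra.
by rewrite invr_ge0 invf_le1; [apply/andP; split; lra|lra].
Qed.

(** [LH0] upgrades the essential bound to every point: if [al x < eta], a small ball around [x]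
    would lie in the exceptional null set, yet balls have positive measure. *)
Lemma inv_exponent_ge (eta : R) : 0 <= eta -> LH0 d al ->
  (ess_sup mu p <= (eta%:E)^-1)%E -> forall x, eta <= al x.
Proof.
move=> eta0 alH pplus x; rewrite leNgt; apply/negP => xeta.
have al0 y : 0 <= al y by have /andP[] := inv_exponent01 y.
have etagt0 : 0 < eta := le_lt_trans (al0 x) xeta.
have /ess_supP aep := pplus.
have [N [mN muN hN]] : {ae mu, forall y, eta <= al y}.
  apply: filterS aep => y; rewrite inver gt_eqF// /inv_exponent.
  have := p_ge1 y; case: (p y) => [r|//|//]; rewrite !lee_fin => r1 hr.
  rewrite inver gt_eqF /=; last lra.
  by rewrite -[leLHS]invrK lef_pV2 ?posrE ?invr_gt0//; lra.
have [C C0 hC] := LH0_mul_ln hX al alH.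
pose eps := eta - al x; have eps0 : 0 < eps by rewrite subr_gt0.
(* On this ball [eps * - ln (d x y)] exceeds [C + 1], hence the [LH0] bound [C], so [al y] stays
   below [eta]. *)
pose r := Num.min 2^-1 (expR (- ((C + 1) / eps))).
have r0 : 0 < r by rewrite lt_min expR_gt0 andbT invr_gt0.
have : (mu (qball d x r) <= mu N)%E.
  apply: le_measure; rewrite ?inE//; first exact: (measurable_qball hX).
  move=> y; rewrite /qball /= lt_min => /andP[y1 y2]; apply: hN => /= hy.
  have [xy|nxy] := pselect (x = y); first by rewrite xy in xeta; lra.
  have d0 : 0 < d x y.
    rewrite lt_neqAle (qm_ge0 (ht_quasi_metric hX)) andbT eq_sym; apply/eqP.
    by move/(qm_eq0 (ht_quasi_metric hX)).
  have lnd : ln (d x y) < - ((C + 1) / eps).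
    by rewrite -[ltRHS]expRK ltr_ln ?posrE// expR_gt0.
  have h1 : C + 1 < eps * - ln (d x y) by rewrite mulrC -ltr_pdivrMr//; lra.
  have h2 : eps * - ln (d x y) <= `|al x - al y| * - ln (d x y).
    apply: ler_wpM2r; last by rewrite /eps ler0_norm; lra.
    have : 0 <= (C + 1) / eps by rewrite divr_ge0 ?(ltW eps0)//; lra.
    lra.
  have := hC x y y1; lra.
by rewrite muN leNgt (ht_ball_gt0 hX).
Qed.

End InverseExponent.

(** * The modular and the conjugate exponent *)

Section VariableExponent.
Context {R : realType} {disp : measure_display} {X : measurableType disp}.
Context {d : X -> X -> R} {mu : {measure set X -> \bar R}}.
Hypothesis hX : homogeneous_type d mu.
Variables (x0 : X) (p : X -> \bar R).
Hypothesis mp : measurable_fun [set: X] p.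
Hypothesis p_ge1 : forall x, (1 <= p x)%E.
Local Notation al := (inv_exponent p).

Let muX_gt0 : (0 < mu [set: X])%E.
Proof.
apply: (lt_le_trans (ht_ball_gt0 hX x0 ltr01)).
by apply: le_measure; rewrite ?inE//; exact: (measurable_qball hX).
Qed.

(** The norm at [+oo] unfolds to an essential supremum only when the whole space has positive
    measure, which the unit ball at [x0] ensures. *)
Lemma Lnormy_le (F : X -> \bar R) (a : \bar R) :
  ('N[mu]_+oo [F] <= a)%E <-> {ae mu, forall x, (`|F x| <= a)%E}.
Proof. by rewrite unlock muX_gt0; split => /ess_supP. Qed.

Definition modular_density (h : X -> R) (x : X) : R :=
  if p x == +oo%E then 0 else `|h x| `^ fine (p x).

Lemma modular_density_ge0 h x : 0 <= modular_density h x.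
Proof. by rewrite /modular_density; case: ifP => // _; exact: powR_ge0. Qed.

(** Where [p] is finite and [h] nonzero the power is an exponential of a product; elsewhere the
    density is 0, since finite exponents are at least 1. *)
Lemma measurable_modular_density h : measurable_fun [set: X] h ->
  measurable_fun [set: X] (modular_density h).
Proof.
move=> mh; pose A := (p @^-1` (~` [set +oo%E])) `&` (h @^-1` (~` [set 0])).
have mA : measurable A.
  apply: measurableI.
    by rewrite -[_ @^-1` _]setTI; apply: mp => //; exact: measurableC.
  by rewrite -[_ @^-1` _]setTI; apply: mh => //; exact: measurableC.
rewrite (_ : modular_density h =
    fun x => \1_A x * expR (fine (p x) * ln `|h x|)); last first.
  apply/funext => x; rewrite /modular_density indicE.
  have [px|px] := eqVneq (p x) +oo%E.
    by rewrite memNset ?mul0r// => -[/(_ px)].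
  have [hx|hx] := eqVneq (h x) 0.
    rewrite memNset ?mul0r; last by move=> -[_ /(_ hx)].
    rewrite hx normr0 powR0//; have := p_ge1 x; move: px.
    by case: (p x) => [r _|//|//]; rewrite lee_fin /= => r1; rewrite gt_eqF//; lra.
  rewrite mem_set ?mul1r; last by split; apply/eqP.
  by rewrite powR_expR// normr_gt0.
apply: measurable_funM => //; apply: (measurableT_comp (@measurable_expR R)).
apply: measurable_funM; first exact: measurableT_comp.
apply: (measurableT_comp (@measurable_ln R)); exact: measurableT_comp.
Qed.

Lemma var_modular_le1 (h : X -> R) : (var_modular mu p h <= 1)%E ->
  (\int[mu]_x (modular_density h x)%:E <= 1)%E /\
  {ae mu, forall x, p x = +oo%E -> `|h x| <= 1}.
Proof.
rewrite /var_modular => hm.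
have I0 : (0 <= \int[mu]_(x in ~` Omega_infty p) (`|h x| `^ fine (p x))%:E)%E.
  by apply: integral_ge0 => x _; rewrite lee_fin powR_ge0.
have N0 : (0 <= 'N[mu]_+oo [(EFin \o h) \_ (Omega_infty p)])%E by exact: Lnorm_ge0.
split.
  apply: le_trans hm; apply: le_trans (leeDl _ N0); rewrite [leRHS]integral_mkcond.
  rewrite le_eqVlt; apply/orP; left; apply/eqP; apply: eq_integral => x _.
  rewrite patchE /modular_density; case: eqVneq => [px|px].
    by rewrite memNset// => /(_ px).
  by rewrite mem_set// => /eqP; rewrite (negPf px).
have /Lnormy_le : ('N[mu]_+oo [(EFin \o h) \_ (Omega_infty p)] <= 1)%E.
  by apply: le_trans hm; exact: leeDr.
by apply: filterS => x + px; rewrite patchE mem_set.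
Qed.

(** Take the root of order [p x]; where [p] is infinite the right side is a power with exponent 0,
    that is, 1. *)
Lemma le_powR_modular_density (h g : X -> R) :
  (forall x, 0 < g x) -> (forall x, modular_density h x <= g x) ->
  {ae mu, forall x, p x = +oo%E -> `|h x| <= 1} ->
  {ae mu, forall x, `|h x| <= g x `^ al x}.
Proof.
move=> g0 hg; apply: filterS => x; have := hg x; have := p_ge1 x.
rewrite /modular_density /inv_exponent.
case: (p x) => [r|_ _|//]; last by rewrite invey /= powRr0 => ->.
rewrite lee_fin /= => r1 hgx _; rewrite inver gt_eqF /=; last lra.
apply: (@le_trans _ _ ((`|h x| `^ r) `^ r^-1)).
  by rewrite -powRrM mulfV ?powRr1//; apply: lt0r_neq0; lra.
apply: ge0_ler_powR => //; rewrite ?nnegrE ?powR_ge0 ?(ltW (g0 x))//.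
by rewrite invr_ge0; lra.
Qed.

Lemma conjugate_exponentE (eta : R) (q : X -> \bar R) x :
  ((p x)^-1 - (q x)^-1 = eta%:E)%E ->
  q x = if al x - eta == 0 then +oo%E else (al x - eta)^-1%:E.
Proof.
rewrite (inv_exponentE p p_ge1) => hq; rewrite -[q x]inveK.
have -> : ((q x)^-1 = (al x - eta)%:E)%E.
  move: hq; case: ((q x)^-1)%E => [r||] //= [] <-.
  by rewrite opprB addrC subrK.
by rewrite inver.
Qed.

End VariableExponent.

(** * Scaling and conclusion *)

Lemma frac_mean_scale {R : realType} {disp : measure_display}
    {X : measurableType disp} (mu : {measure set X -> \bar R})
    (eta l : R) (f : X -> R) (B : set X) : 0 < l -> measurable B ->
  measurable_fun [set: X] f ->
  frac_mean mu eta f B = (l%:E * frac_mean mu eta (fun x => (f x / l)%R) B)%E.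
Proof.
move=> l0 mB mf; rewrite /frac_mean.
have -> : (\int[mu]_(y in B) `|f y|%:E = l%:E * \int[mu]_(y in B) `|f y / l|%:E)%E.
  rewrite -ge0_integralZl_EFin//; last 2 first.
  - apply/measurable_EFinP; apply: measurableT_comp => //; apply: measurable_funM => //.
    exact: measurable_funTS.
  - exact: ltW.
  apply: eq_integral => y _; rewrite -EFinM normrM (ger0_norm (_ : 0 <= l^-1)).
    by rewrite mulrC divfK// lt0r_neq0.
  by rewrite invr_ge0 ltW.
by rewrite (muleCA _ l%:E) (muleCA _ l%:E).
Qed.

Lemma frac_maximal_scale {R : realType} {disp : measure_display}
    {X : measurableType disp} {d : X -> X -> R}
    {mu : {measure set X -> \bar R}} (hX : homogeneous_type d mu)
    (eta l t : R) (f : X -> R) x : 0 < l -> measurable_fun [set: X] f ->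
  (t%:E < frac_maximal d mu eta f x)%E ->
  ((t / l)%:E < frac_maximal d mu eta (fun y => (f y / l)%R) x)%E.
Proof.
move=> l0 mf /ereal_sup_gt[_ [B [[c [r [r0 BE]]] Bx] <-]].
rewrite -/(frac_mean mu eta f B) (frac_mean_scale mu eta l)//; last first.
  by rewrite BE; exact: (measurable_qball hX).
rewrite -lte_pdivrMl// -EFinM mulrC => h; apply: (lt_le_trans h).
by apply: ereal_sup_ubound; exists B => //; split => //; exists c, r.
Qed.

(** By homogeneity it is enough that each [l] admissible in the norm of [f] yields the admissible
    value [C * (2 * Kf) * l / t] for the indicator. *)
Lemma weak_type_bound_LH {R : realType} {disp : measure_display}
    {X : measurableType disp} {d : X -> X -> R}
    {mu : {measure set X -> \bar R}} (hX : homogeneous_type d mu) (x0 : X)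
    (eta : R) (p q : X -> \bar R) : 0 <= eta -> measurable_fun [set: X] p ->
  (forall x, (1 <= p x)%E) -> (ess_sup mu p <= (eta%:E)^-1)%E ->
  (forall x, ((p x)^-1 - (q x)^-1 = eta%:E)%E) ->
  LH d x0 (inv_exponent p) -> weak_type_bound d mu eta p q.
Proof.
move=> eta0 mp p1 pplus hq [h0 hinf]; set al := inv_exponent p.
have al01 := inv_exponent01 p p1.
have aleta := inv_exponent_ge hX p p1 eta eta0 h0 pplus.
have al_itv x : eta <= al x <= 1.
  by rewrite aleta; have /andP[] := al01 x.
have [m [M [M0 hM]]] := integral_decay_fin hX x0.
(* The density [g] has integral at most 1 from the modular plus [M] from the weight. *)
have [|C [Kf [C1 Kf1 hC]]] :=
  weak_type_majorant hX x0 eta al eta0 al_itv h0 hinf m (1 + M).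
  by rewrite lerDl.
have C0 : 0 < C by lra.
have Kf0 : 0 < 2 * Kf by lra.
have C'0 : 0 < C * (2 * Kf) by exact: mulr_gt0.
exists (C * (2 * Kf)); split=> // f [mf _].
apply: ge_ereal_sup => _ [t /= t0 <-].
rewrite -lee_pdivrMl//; apply: le_ereal_inf_tmp => _ [l [l0 hl] <-].
rewrite lee_pdivrMl// -lee_pdivlMl// -!EFinM.
pose L := t^-1 * (C * (2 * Kf) * l).
have L0 : 0 < L by rewrite mulr_gt0 ?invr_gt0// mulr_gt0.
apply: ereal_inf_lbound; exists L => //=; split=> //.
pose h x := f x / l.
have mh : measurable_fun [set: X] h by exact: measurable_funM.
have [ih aeh] := var_modular_le1 hX x0 p h hl.
pose g x := modular_density p h x + decay d x0 m x.
have mS := measurable_decay hX x0 m.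
have md := measurable_modular_density p mp p1 h mh.
have d0 x : 0 <= modular_density p h x := modular_density_ge0 p h x.
have S0 x : 0 < decay d x0 m x := decay_gt0 x0 m x.
have mg : measurable_fun [set: X] g by exact: measurable_funD.
have gS x : decay d x0 m x <= g x by rewrite lerDr.
have gd x : modular_density p h x <= g x by rewrite lerDl ltW.
have g0 x : 0 < g x := lt_le_trans (S0 x) (gS x).
have ig : (\int[mu]_z (g z)%:E <= (1 + M)%:E)%E.
  rewrite EFinD /g; under eq_integral do rewrite EFinD.
  rewrite ge0_integralD//.
  - exact: leeD.
  - by move=> x _; rewrite lee_fin.
  - exact/measurable_EFinP.
  - by move=> x _; rewrite lee_fin ltW.
  - exact/measurable_EFinP.
have hg := le_powR_modular_density p p1 h g g0 gd aeh.
have tl0 : 0 < t / l by exact: divr_gt0.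
have [u [mu_ u0 iu hu]] := hC h g mh mg gS ig hg (t / l) tl0.
have LE : L^-1 = t / l / C * (2 * Kf)^-1.
  by rewrite /L; field; rewrite !lt0r_neq0//; lra.
have Li0 : 0 <= L^-1 by rewrite invr_ge0 ltW.
have hE x : (t%:E < frac_maximal d mu eta f x)%E ->
    (al x = eta -> t / l <= C) /\
    (eta < al x -> (((t / l / C) `^ (al x - eta)^-1)%:E <= u x)%E).
  by move=> /(frac_maximal_scale hX eta l t f x l0 mf)/hu.
set E := [set x | _].
(* The factor 2 in [2 * Kf] leaves one half for the integral and one half for the essential
   supremum. *)
have half : (2^-1 + 2^-1 = 1 :> R) by lra.
rewrite /var_modular -[leRHS]/((1 : R)%:E) -half EFinD; apply: leeD.
  apply: (@le_trans _ _ (\int[mu]_x ((2 * Kf)^-1%:E * u x))%E).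
    apply: le_integral_nonmeasurable => x.
    - by rewrite lee_fin powR_ge0.
    - by apply: mule_ge0 => //; rewrite lee_fin invr_ge0 ltW.
    rewrite /Omega_infty /= (conjugate_exponentE p p1 eta q x (hq x)) -/al.
    case: eqVneq => //= be0 _.
    have bepos : 0 < al x - eta by rewrite lt_neqAle eq_sym be0 subr_ge0 aleta.
    (* The conjugate exponent is at least 1, so raising [(2 * Kf)^-1 <= 1] to it only decreases
       it. *)
    have beinv1 : 1 <= (al x - eta)^-1.
      by rewrite invf_ge1//; have /andP[_ ?] := al_itv x; lra.
    rewrite indicE; have [/set_mem Ex|nEx] := boolP (x \in E); last first.
      rewrite mul0r normr0 powR0; last by rewrite invr_eq0.
      by apply: mule_ge0 => //; rewrite lee_fin invr_ge0 ltW.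
    rewrite mul1r ger0_norm// LE powRM; last 2 first.
    - by rewrite divr_ge0 ?ltW.
    - by rewrite invr_ge0 ltW.
    have [_ hx] := hE x Ex; rewrite mulrC EFinM.
    apply: lee_pmul => //; rewrite ?lee_fin ?powR_ge0//; last first.
      by apply: hx; rewrite -subr_gt0.
    apply: ge1r_powR => //; rewrite invr_gt0 Kf0 /= invf_le1//; lra.
  rewrite ge0_integralZl_EFin//; last by rewrite invr_ge0 ltW.
  rewrite lee_pdivrMl// -EFinM; apply: le_trans iu _; rewrite lee_fin; lra.
apply/(Lnormy_le hX x0); apply: aeW => x.
rewrite patchE; case: ifPn => [/set_mem|_]; last by rewrite abse0 lee_fin; lra.
rewrite /Omega_infty /= (conjugate_exponentE p p1 eta q x (hq x)) -/al.
case: eqVneq => //= be0 _; rewrite indicE lee_fin.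
have [/set_mem Ex|nEx] := boolP (x \in E); last by rewrite mul0r normr0; lra.
have [hx _] := hE x Ex.
have hx1 : t / l / C <= 1 by rewrite ler_pdivrMr// mul1r; apply: hx; lra.
rewrite mul1r ger0_norm// LE; apply: (@le_trans _ _ (2 * Kf)^-1).
  by apply: ler_piMl => //; rewrite invr_ge0 ltW.
rewrite lef_pV2 ?posrE//; lra.
Qed.

Theorem theorem1p2 (R : realType) (disp : measure_display)
    (X : measurableType disp) (d : X -> X -> R)
    (mu : {measure set X -> \bar R}) (hX : homogeneous_type d mu) (x0 : X)
    (eta : R) (eta_ge0 : 0 <= eta) (eta_lt1 : eta < 1)
    (p : X -> \bar R) (mp : measurable_fun [set: X] p)
    (p_ge1 : forall x, (1 <= p x)%E)
    (p_minus : ess_inf mu p = 1%E)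
    (p_plus : (ess_sup mu p <= (eta%:E)^-1)%E)
    (q : X -> \bar R) (hq : forall x, ((p x)^-1 - (q x)^-1 = eta%:E)%E) :
  (LH d x0 (inv_exponent p) -> weak_type_bound d mu eta p q) /\
  ((mu [set: X] < +oo)%E -> LH0 d (inv_exponent p) ->
    weak_type_bound d mu eta p q).
Proof.
split=> [hLH|muX hLH0].
  exact: (weak_type_bound_LH hX x0 eta p q eta_ge0 mp p_ge1 p_plus hq hLH).
(* Finite measure bounds the distances to [x0], and then [LHinfty] holds for any function with
   values in [0, 1]. *)
have [D hD] := finite_measure_bounded hX x0 muX.
apply: (weak_type_bound_LH hX x0 eta p q eta_ge0 mp p_ge1 p_plus hq).
by split=> //; exact: (LHinfty_bounded hX x0 D _ hD (inv_exponent01 p p_ge1)).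
Qed.
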